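(* Let $m\ge0$, $a,n,\ell\ge1$ and $0\le p\le\ell$ be integers. Let $\mathcal{H}^p_\ell(m,a,n)$ be the arrangement in $\mathbb{R}^\ell$ consisting of the hyperplanes $x_i-x_j=s$ for $1\le i<j\le\ell$ and integers $1-a\le s\le a$; $x_i=s$ for $1\le i\le p$ and integers $-m\le s\le na-1$; and $x_i=s$ for $p<i\le\ell$ and integers $-m-1\le s\le na-1$. Then the cone $\mathbf{c}\mathcal{H}^p_\ell(m,a,n)$ is ind-flag-accurate with exponents $1$, $c$ (with multiplicity $p$) and $c+1$ (with multiplicity $\ell-p$), where $c=m+a(\ell+n-1)$. Consequently, for integers $m,d\ge0$, the arrangement in $\mathbb{R}^\ell$ consisting of $x_i-x_j=0$ and $x_i-x_j=1$ ($1\le i<j\le\ell$), $x_i=s$ for $1\le i\le p$, $-m\le s\le d$, and $x_i=s$ for $p<i\le\ell$, $-m-1\le s\le d$ (which equals $\mathcal{H}^p_\ell(m,1,d+1)$) has ind-flag-accurate cone with exponents $1$, $(\ell+m+d)$ with multiplicity $p$, and $(\ell+m+d+1)$ with multiplicity $\ell-p$.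
   Context: For an affine arrangement $\mathcal{A}$ in $\mathbb{R}^\ell$, its cone $\mathbf{c}\mathcal{A}$ is the central arrangement in $V'=\mathbb{R}^{\ell+1}$ (extra coordinate $z$) consisting of the hyperplanes $a_1x_1+\dots+a_\ell x_\ell=dz$ for each hyperplane $a_1x_1+\dots+a_\ell x_\ell=d$ of $\mathcal{A}$, together with $z=0$. For a central arrangement $\mathcal{A}$ in $W=\mathbb{R}^N$: $L(\mathcal{A})$ is the set of intersections of subsets of $\mathcal{A}$ (including $W$); $\mathcal{A}^X=\{H\cap X:H\in\mathcal{A},X\not\subseteq H\}$; $\mathcal{A}$ is free if $D(\mathcal{A})=\{\theta\in\mathrm{Der}(S):\theta(\alpha_H)\in\alpha_HS\ \forall H\}$ is free over $S=\mathbb{R}[x_1,\dots,x_N]$, exponents being degrees of a homogeneous basis. Inductively free arrangements: smallest class containing empty arrangements and containing $\mathcal{A}$ whenever some $H\in\mathcal{A}$ has $\mathcal{A}\setminus\{H\}$ and $\mathcal{A}^H$ in the class with $\exp(\mathcal{A}^H)\subseteq\exp(\mathcal{A}\setminus\{H\})$. $\mathcal{A}$, free with exponents $e_1\le\dots\le e_N$, is ind-flag-accurate if it is inductively free and there is a flag $X_1\subseteq\dots\subseteq X_N=W$ in $L(\mathcal{A})$ with $\dim X_d=d$ and each $\mathcal{A}^{X_d}$ inductively free with exponents $(e_1,\dots,e_d)$. *)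

(* Defs.v *)
From mathcomp Require Import all_boot all_order all_algebra.
From mathcomp Require Import mpoly.
From mathcomp Require Import classical_sets cardinality reals.

Set Implicit Arguments.
Unset Strict Implicit.
Unset Printing Implicit Defensive.

Import Order.TTheory GRing.Theory Num.Theory.
Local Open Scope ring_scope.
Local Open Scope classical_set_scope.

(* A central arrangement lives in an arbitrary finite-dimensional real vector
   space V rather than only in 'rV_N, so that a restriction A^X is literally an
   arrangement in the space X.  It is a set of subspaces; [arrangement] says
   that the set is finite and that its elements have codimension 1. *)

Definition arrangement (R : realType) (V : vectType R)
    (A : set {vspace V}) : Prop :=
  finite_set A /\ forall H, A H -> (\dim H).+1 = \dim {:V}.

(* The preimage of H under the inclusion X -> V is H :&: X, seen inside X. *)
Definition restriction (R : realType) (V : vectType R)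
    (A : set {vspace V}) (X : {vspace V}) : set {vspace (subvs_of X)} :=
  [set (linfun (vsval : subvs_of X -> V) @^-1: H)%VS
     | H in [set H | A H /\ ~~ (X <= H)%VS]].
Arguments restriction {R V} A X &.

(* L(A); the empty intersection is V. *)
Definition in_lattice (R : realType) (V : vectType R)
    (A : set {vspace V}) (X : {vspace V}) : Prop :=
  exists B : seq {vspace V},
    (forall H, H \in B -> A H) /\ X = (\bigcap_(H <- B) H)%VS.

(* The polynomial ring S of V: the variable 'X_i stands for the i-th coordinate
   with respect to the basis [vbasis {:V}].  Another basis would only change S
   by a linear substitution, which affects neither freeness nor exponents. *)
Definition form_poly (R : realType) (V : vectType R)
    (alpha : 'Hom(V, R^o)) : {mpoly R[\dim {:V}]} :=
  \sum_(i < \dim {:V}) (alpha (vbasis {:V})`_i : R) *: 'X_i.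

Definition derivation (R : realType) (n : nat)
    (theta : {mpoly R[n]} -> {mpoly R[n]}) : Prop :=
  (forall (k : R) f g, theta (k *: f + g) = k *: theta f + theta g) /\
  (forall f g, theta (f * g) = theta f * g + f * theta g).

(* D(A).  The linear form alpha_H is determined by H up to a nonzero scalar,
   which does not affect the condition. *)
Definition log_derivation (R : realType) (V : vectType R) (A : set {vspace V})
    (theta : {mpoly R[\dim {:V}]} -> {mpoly R[\dim {:V}]}) : Prop :=
  derivation theta /\
  forall (H : {vspace V}) (alpha : 'Hom(V, R^o)), A H -> lker alpha = H ->
    exists g, theta (form_poly alpha) = form_poly alpha * g.

(* D(A) is free over S with a homogeneous basis whose i-th element has
   polynomial degree e_i, i.e. maps each variable to a form of degree e_i.
   The order of the list e is immaterial: it stands for a multiset. *)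
Definition free_with_exponents (R : realType) (V : vectType R)
    (A : set {vspace V}) (e : seq nat) : Prop :=
  exists theta : 'I_(size e) -> {mpoly R[\dim {:V}]} -> {mpoly R[\dim {:V}]},
    [/\ forall i, log_derivation A (theta i),
        forall i j, theta i 'X_j \is (nth 0%N e i).-homog
      & forall eta, log_derivation A eta ->
          exists! c : {ffun 'I_(size e) -> {mpoly R[\dim {:V}]}},
            forall f, eta f = \sum_i c i * theta i f].

Definition multisubset (e1 e2 : seq nat) : Prop :=
  forall k, (count_mem k e1 <= count_mem k e2)%N.

Inductive inductively_free (R : realType) :
    forall V : vectType R, set {vspace V} -> Prop :=
| inductively_free_empty (V : vectType R) :
    inductively_free (set0 : set {vspace V})
| inductively_free_add (V : vectType R) (A : set {vspace V}) (H : {vspace V})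
    (e' e'' : seq nat) :
    arrangement A -> A H ->
    inductively_free (A `\ H) ->
    inductively_free (restriction A H) ->
    free_with_exponents (A `\ H) e' ->
    free_with_exponents (restriction A H) e'' ->
    multisubset e'' e' ->
    inductively_free A.

(* The flag X_1 <= ... <= X_N is given by a function on nat, of which only the
   values at 1, ..., N matter. *)
Definition ind_flag_accurate (R : realType) (V : vectType R)
    (A : set {vspace V}) : Prop :=
  arrangement A /\ inductively_free A /\
  exists (e : seq nat) (X : nat -> {vspace V}),
    [/\ size e = \dim {:V}, sorted leq e, free_with_exponents A e,
        X (\dim {:V}) = fullv
      & [/\ forall d, (0 < d < \dim {:V})%N -> (X d <= X d.+1)%VS
        & forall d, (0 < d <= \dim {:V})%N ->
            [/\ in_lattice A (X d), \dim (X d) = d,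
                inductively_free (restriction A (X d))
              & free_with_exponents (restriction A (X d)) (take d e)]]].

(* An affine arrangement in R^l is a set of affine hyperplanes, each of them a
   set of points. *)
Definition affine_hyperplane (R : realType) (l : nat)
    (a : 'cV[R]_l) (d : R) : set 'rV[R]_l :=
  [set x | (x *m a) 0 0 = d].

Definition linear_hyperplane (R : realType) (n : nat)
    (b : 'cV[R]_n) : {vspace 'rV[R]_n} := lker (linfun (mulmxr b)).

(* The points of R^(l+1) are row_mx x z: the extra coordinate z is the last. *)
Definition cone (R : realType) (l : nat) (A : set (set 'rV[R]_l)) :
    set {vspace 'rV[R]_(l + 1)} :=
  [set K | (exists (a : 'cV[R]_l) (d : R),
              [/\ a != 0, A (affine_hyperplane a d)
                & K = linear_hyperplane (col_mx a (- d)%:M)])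
           \/ K = linear_hyperplane (col_mx 0 1%:M)].

(* Coordinates are indexed from 0, so that 1 <= i <= p becomes i < p. *)
Definition arrH (R : realType) (l p m a n : nat) : set (set 'rV[R]_l) :=
  [set K | (exists (i j : 'I_l) (s : int),
              [/\ (i < j)%N, 1 - a%:Z <= s <= a%:Z
                & K = [set x : 'rV[R]_l | x 0 i - x 0 j = s%:~R]])
        \/ (exists (i : 'I_l) (s : int),
              [/\ (i < p)%N, - m%:Z <= s <= (n * a)%:Z - 1
                & K = [set x : 'rV[R]_l | x 0 i = s%:~R]])
        \/ (exists (i : 'I_l) (s : int),
              [/\ (p <= i)%N, - m%:Z - 1 <= s <= (n * a)%:Z - 1
                & K = [set x : 'rV[R]_l | x 0 i = s%:~R]])].
Arguments arrH : clear implicits.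

Definition arrK (R : realType) (l p m d : nat) : set (set 'rV[R]_l) :=
  [set K | (exists i j : 'I_l,
              (i < j)%N /\ (K = [set x : 'rV[R]_l | x 0 i - x 0 j = 0] \/
                            K = [set x : 'rV[R]_l | x 0 i - x 0 j = 1]))
        \/ (exists (i : 'I_l) (s : int),
              [/\ (i < p)%N, - m%:Z <= s <= d%:Z
                & K = [set x : 'rV[R]_l | x 0 i = s%:~R]])
        \/ (exists (i : 'I_l) (s : int),
              [/\ (p <= i)%N, - m%:Z - 1 <= s <= d%:Z
                & K = [set x : 'rV[R]_l | x 0 i = s%:~R]])].
Arguments arrK : clear implicits.

(* Main.v *)
Require Import Defs.
From HB Require Import structures.
From mathcomp Require Import all_boot all_order all_algebra.
From mathcomp Require Import mpoly.
From mathcomp Require Import classical_sets cardinality reals.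
From mathcomp Require Import boolp zify ring.

(** Inductive freeness is built up one hyperplane at a time with Terao's
    addition theorem: if A \ {H} is free with exponents (b, e) and A^H is free
    with exponents e, then A is free with exponents (b+1, e).  Its proof here
    needs the degree |A \ {H}| - |A^H| of a polynomial B on H that divides the
    restriction to H of theta(alpha_H) for all theta in D(A \ {H}); this degree
    is b because the number of hyperplanes is carried along as the sum of the
    exponents.

    Arrangements are described by linear forms x_0, ..., x_(l-1), z that are
    independent on the ambient space V (of any larger dimension), with
    x_i = s z for s in an interval [lo - [p <= i], lo + L + [i < q]).
    Restricting to x_k = s0 z with s0 adjacent to the k-th interval enlarges
    the other intervals by a and gives the same kind of arrangement for l - 1
    forms.  With L >= a the exponents are 1 and
    L + [p <= i] + [i < q] + a(l-1).  The start of the chain, where there is no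
    coordinate hyperplane (extended Shi arrangement), is the case l - 1 for the
    forms x_i - x_(l-1), with one exponent 0 more; filling the intervals one
    value at a time brings this exponent from 0 to a l, and all restrictions
    met on the way have intervals of length 2a.

    The flag is obtained by repeatedly restricting to the lowest value of a
    longest interval: the largest exponent disappears and the arrangement keeps
    its shape. *)

Set Implicit Arguments.
Unset Strict Implicit.
Unset Printing Implicit Defensive.

Import Order.TTheory GRing.Theory Num.Theory.
Local Open Scope ring_scope.

(** * Divisibility in integral domains *)

Section IdomainDivisibility.
Variable D : idomainType.
Implicit Types p q x y : D.

Definition divides p q : Prop := exists g, q = p * g.

Lemma divides_refl p : divides p p. Proof. by exists 1; rewrite mulr1. Qed.

Lemma divides0 p : divides p 0. Proof. by exists 0; rewrite mulr0. Qed.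

Lemma dividesMr p q x : divides p q -> divides p (q * x).
Proof. by move=> [g ->]; exists (g * x); rewrite mulrA. Qed.

Lemma dividesMl p q x : divides p q -> divides p (x * q).
Proof. by rewrite mulrC; apply: dividesMr. Qed.

Lemma dividesD p q x : divides p q -> divides p x -> divides p (q + x).
Proof. by move=> [g ->] [h ->]; exists (g + h); rewrite mulrDr. Qed.

Lemma divides_sum (I : Type) (r : seq I) p (F : I -> D) :
  (forall i, divides p (F i)) -> divides p (\sum_(i <- r) F i).
Proof.
move=> pF; elim: r => [|i r IH]; first by rewrite big_nil; apply: divides0.
by rewrite big_cons; apply: dividesD.
Qed.

Definition prime_elt p : Prop :=
  p != 0 /\ forall x y, divides p (x * y) -> divides p x \/ divides p y.

Lemma prime_pow_divides p q k x :
  prime_elt p -> ~ divides p q -> divides (p ^+ k) (q * x) ->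
  divides (p ^+ k) x.
Proof.
move=> [p0 pP] npq; elim: k x => [|k IH] x; first by exists x; rewrite mul1r.
move=> [g Eg].
have [//|[y xE]] : divides p q \/ divides p x.
  by apply: pP; exists (p ^+ k * g); rewrite Eg exprS mulrA.
have [|h yE] := IH y.
  exists g; apply: (mulfI p0).
  by rewrite [LHS]mulrCA -xE Eg exprS mulrA.
by exists h; rewrite xE yE exprS mulrA.
Qed.

Lemma prime_ndivides_pow p q k :
  prime_elt p -> ~ divides p 1 -> ~ divides p q -> ~ divides p (q ^+ k).
Proof.
move=> [p0 pP] np1 npq; elim: k => [//|k IH].
by rewrite exprS => /pP[].
Qed.

(** A substitute for unique factorization: as no prime of the family divides another, dividing out
    one power leaves the remaining divisibilities intact. *)
Lemma prod_prime_pow_divides (I : eqType) (r : seq I) (p : I -> D)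
    (k : I -> nat) x :
  uniq r ->
  {in r, forall i, prime_elt (p i) /\ ~ divides (p i) 1} ->
  {in r &, forall i j, i != j -> ~ divides (p i) (p j)} ->
  {in r, forall i, divides (p i ^+ k i) x} ->
  divides (\prod_(i <- r) p i ^+ k i) x.
Proof.
elim: r x => [|i r IH] x; first by rewrite big_nil; exists x; rewrite mul1r.
move=> /= /andP[ir ur] pP np kx; rewrite big_cons.
have [y xE] := kx i (mem_head _ _).
have [||||g yE] // := IH y.
- by move=> j jr; apply: pP; rewrite inE jr orbT.
- by move=> j1 j2 j1r j2r; apply: np; rewrite inE ?j1r ?j2r orbT.
- move=> j jr; have jr' : j \in i :: r by rewrite inE jr orbT.
  have [pj pj1] := pP j jr'.
  have := kx j jr'; rewrite xE; apply: prime_pow_divides => //.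
  apply: prime_ndivides_pow => //; apply: np => //; first exact: mem_head.
  by apply: contraNneq ir => <-.
by exists g; rewrite xE yE mulrA.
Qed.

(* Division-free elimination of the first column. *)
Lemma rows_dependent m (A : 'I_m.+1 -> 'I_m -> D) :
  exists u : 'I_m.+1 -> D,
    (exists i, u i != 0) /\ forall j, \sum_i u i * A i j = 0.
Proof.
elim: m A => [|m IH] A.
  by exists (fun=> 1); split; [exists ord0; apply: oner_neq0 | case].
have [/forallP A0|] := boolP [forall i, A i ord0 == 0].
  have [u [[i ui] uA]] := IH (fun i j => A (lift ord0 i) (lift ord0 j)).
  exists (fun i => oapp u 0 (unlift ord0 i)); split.
    by exists (lift ord0 i); rewrite liftK.
  move=> j; rewrite big_ord_recl unlift_none /= mul0r add0r.
  case: (unliftP ord0 j) => [j' ->|->].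
    by under eq_bigr do rewrite liftK; apply: uA.
  by rewrite big1 // => k _; rewrite (eqP (A0 _)) mulr0.
rewrite negb_forall => /existsP[i0 Ai0].
have [u [[i ui] uA]] := IH (fun i j =>
  A i0 ord0 * A (lift i0 i) (lift ord0 j) -
  A (lift i0 i) ord0 * A i0 (lift ord0 j)).
(* The relation [u] is scaled by the pivot [A i0 ord0], which keeps it nontrivial; the pivot row
   gets the coefficient that cancels column 0. *)
exists (fun i => if unlift i0 i is Some k then u k * A i0 ord0
                 else - \sum_k u k * A (lift i0 k) ord0); split.
  by exists (lift i0 i); rewrite liftK mulf_neq0.
move=> j; rewrite (bigD1_ord i0) //= unlift_none.
under [X in _ + X]eq_bigr do rewrite liftK.
rewrite mulNr mulr_suml addrC -sumrB.
case: (unliftP ord0 j) => [j' ->|->]; last first.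
  by rewrite big1 // => k _; ring.
rewrite -[RHS](uA j'); apply: eq_bigr => k _; ring.
Qed.

End IdomainDivisibility.

(** * Pullbacks of polynomials and derivations *)

Section Functionals.
Variables (R : realType) (V : vectType R).
Implicit Types (a b : 'Hom(V, R^o)) (H : {vspace V}).

Lemma functional_dual a : a != 0 -> exists u, a u = 1.
Proof.
move/lfunPn => [u]; rewrite zero_lfunE => au.
exists ((a u : R)^-1 *: u); rewrite linearZ /=.
by rewrite -[_ *: _]/(_ * _) mulVf.
Qed.

Lemma lker_sub_scale a b : (lker a <= lker b)%VS -> exists c : R, b = c *: a.
Proof.
have [->|/functional_dual[u au]] := eqVneq a 0 => ab.
  exists 0; rewrite scaler0; apply/lfunP => v; rewrite zero_lfunE; apply/eqP.
  by rewrite -memv_ker (subvP ab) // memv_ker zero_lfunE.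
exists (b u); apply/lfunP => v; rewrite lfunE /=.
have : v - (a v : R) *: u \in lker b.
  apply: (subvP ab); rewrite memv_ker linearB linearZ /= au.
  by rewrite -[_ *: 1]/(_ * 1) mulr1 subrr.
rewrite memv_ker linearB linearZ /= subr_eq0 => /eqP ->.
by rewrite -[LHS]/(_ * _) -[RHS]/(_ * _) mulrC.
Qed.

Lemma dim_cap_lker H a v : v \in H -> a v != 0 ->
  (\dim (H :&: lker a)).+1 = \dim H.
Proof.
move=> vH av; rewrite -(limg_ker_dim a H) -addn1; congr (_ + _)%N.
apply/eqP; rewrite eq_sym eqn_leq; apply/andP; split.
  by rewrite (leq_trans (dimvS (subvf _))) // dimvf.
rewrite lt0n dimv_eq0; apply: contraNneq av => a0.
by have := memv_img a vH; rewrite a0 memv0.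
Qed.

Lemma dim_lker a : a != 0 -> (\dim (lker a)).+1 = \dim {:V}.
Proof.
move=> /lfunPn[v]; rewrite zero_lfunE => av.
by rewrite -(dim_cap_lker (memvf v) av) capfv.
Qed.

(** The form is the coordinate of the projection along [H] onto a complement, which is a line. *)
Lemma hyperplane_lker H : (\dim H).+1 = \dim {:V} ->
  exists a : 'Hom(V, R^o), a != 0 /\ lker a = H.
Proof.
move=> dH; set C := (H^C)%VS.
have dC : \dim C = 1%N by rewrite dimv_compl -dH subSnn.
have CH : (C :&: H = 0)%VS by rewrite capvC capv_compl.
have CHf : (C + H = fullv)%VS by rewrite addvC addv_complf.
have i0 : 'I_(\dim C) by rewrite dC; exact: ord0.
pose a : 'Hom(V, R^o) :=
  (linfun (coord (vbasis C) i0 : V -> R^o) \o daddv_pi C H)%VF.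
have aE v : a v = coord (vbasis C) i0 (daddv_pi C H v).
  by rewrite comp_lfunE lfunE.
have piE v : daddv_pi C H v + daddv_pi H C v = v.
  by apply: daddv_pi_add => //; rewrite CHf memvf.
have kH : lker a = H.
  apply/vspaceP => v; rewrite memv_ker aE; apply/idP/idP => [/eqP a0|vH].
    rewrite -[v]piE (coord_vbasis (memv_pi _ _ v)) big1 ?add0r ?memv_pi //.
    move=> i _; have -> : i = i0; last by rewrite a0 scale0r.
    by apply/val_inj; have := (valP i, valP i0) => -[] /=; lia.
  have : daddv_pi C H v \in (C :&: H)%VS.
    rewrite memv_cap memv_pi /= -[daddv_pi C H v](addrK (daddv_pi H C v)) piE.
    by rewrite rpredB ?memv_pi.
  by rewrite CH memv0 => /eqP ->; rewrite linear0.
exists a; split => //; apply/eqP => a0; move: dH.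
suff -> : H = fullv by lia.
by rewrite -kH a0; apply/vspaceP => v; rewrite memv_ker zero_lfunE eqxx memvf.
Qed.

End Functionals.

Section PolynomialPullback.
Variable R : realType.
Implicit Types U V W : vectType R.

Lemma form_poly_linear V : linear (@form_poly R V).
Proof.
move=> k a b; rewrite /form_poly scaler_sumr -big_split /=.
by apply: eq_bigr => i _; rewrite !lfunE /= lfunE scalerDl scalerA.
Qed.

HB.instance Definition _ V := GRing.isLinear.Build R 'Hom(V, R^o)
  {mpoly R[\dim {:V}]} _ (@form_poly R V) (@form_poly_linear V).

Lemma form_polyB V (a b : 'Hom(V, R^o)) :
  form_poly (a - b) = form_poly a - form_poly b.
Proof. exact: linearB. Qed.

Lemma form_poly_homog V (a : 'Hom(V, R^o)) : form_poly a \is 1.-homog.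
Proof.
by apply: rpred_sum => i _; apply: rpredZ; rewrite dhomogX /= mdeg1.
Qed.

Definition coord_form V (i : 'I_(\dim {:V})) : 'Hom(V, R^o) :=
  linfun (coord (vbasis {:V}) i : V -> R^o).

Lemma coord_formE V i (j : 'I_(\dim {:V})) :
  coord_form i (vbasis {:V})`_j = (j == i)%:R.
Proof. by rewrite lfunE /= coord_free // (basis_free (vbasisP _)). Qed.

Lemma form_poly_coord V (i : 'I_(\dim {:V})) : form_poly (coord_form i) = 'X_i.
Proof.
rewrite /form_poly (bigD1 i) //= coord_formE eqxx scale1r big1 ?addr0 // => j ji.
by rewrite coord_formE (negbTE ji) scale0r.
Qed.

Lemma coord_form_sum V (a : 'Hom(V, R^o)) :
  a = \sum_(i < \dim {:V}) (a (vbasis {:V})`_i : R) *: coord_form i.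
Proof.
apply/lfunP => v; rewrite sum_lfunE {1}(coord_vbasis (memvf v)) linear_sum /=.
apply: eq_bigr => i _; rewrite linearZ lfunE /= lfunE /=.
by rewrite -[LHS]/(_ * _) -[RHS]/(_ * _) mulrC.
Qed.

Lemma form_poly_eq0 V (a : 'Hom(V, R^o)) : form_poly a = 0 -> a = 0.
Proof.
move=> a0; rewrite [a]coord_form_sum big1 // => i _.
have := congr1 (mcoeff U_(i)%MM) a0; rewrite mcoeff0 /form_poly raddf_sum /=.
rewrite (bigD1 i) //= mcoeffZ mcoeffX eqxx mulr1 big1 ?addr0 => [->|j ji].
  by rewrite scale0r.
rewrite mcoeffZ mcoeffX (negbTE (_ : U_(j)%MM != U_(i)%MM)) ?mulr0 //.
apply: contraNneq ji => /mnmP/(_ j); rewrite !mnm1E eqxx eq_sym.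
by case: (j == i).
Qed.

(** Composition of polynomial functions with [g], written as a substitution in the chosen
    coordinates; contravariant in [g]. *)
Definition pullback W V (g : 'Hom(W, V)) :
    {mpoly R[\dim {:V}]} -> {mpoly R[\dim {:W}]} :=
  comp_mpoly [tuple form_poly (coord_form i \o g)%VF | i < \dim {:V}].

HB.instance Definition _ W V (g : 'Hom(W, V)) :=
  GRing.LRMorphism.on (pullback g).

Lemma pullbackX W V (g : 'Hom(W, V)) i :
  pullback g 'X_i = form_poly (coord_form i \o g)%VF.
Proof. by rewrite /pullback comp_mpolyXU -tnth_nth tnth_mktuple. Qed.

Lemma pullback_form W V (g : 'Hom(W, V)) a :
  pullback g (form_poly a) = form_poly (a \o g)%VF.
Proof.
rewrite {1}/form_poly linear_sum /= [in RHS](coord_form_sum a).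
have -> : ((\sum_(i < \dim {:V}) (a (vbasis {:V})`_i : R) *: coord_form i) \o g)%VF =
  \sum_(i < \dim {:V}) (a (vbasis {:V})`_i : R) *: (coord_form i \o g)%VF.
  apply/lfunP => w; rewrite comp_lfunE !sum_lfunE; apply: eq_bigr => i _.
  by rewrite !scale_lfunE comp_lfunE.
rewrite linear_sum; apply: eq_bigr => i _.
by rewrite !linearZ /= pullbackX.
Qed.

Lemma pullback_homog W V (g : 'Hom(W, V)) d f :
  f \is d.-homog -> pullback g f \is d.-homog.
Proof.
move=> /dhomogP fd; rewrite [f]mpolyE linear_sum big_seq; apply: rpred_sum => m mf.
rewrite linearZ; apply: rpredZ; rewrite mpolyXE_id rmorph_prod.
rewrite -(fd m mf) /= mdegE; elim/big_rec2: _ => [|i k q _ IH].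
  exact: dhomog1.
apply: dhomogM => //; rewrite rmorphXn /= pullbackX.
have := dhomogMn (m i) (form_poly_homog (coord_form i \o g)%VF).
by rewrite mul1n.
Qed.

Lemma mpoly_closure_ind n (P : {mpoly R[n]} -> Prop) :
  (forall c, P c%:MP) -> (forall i, P 'X_i) ->
  (forall f g, P f -> P g -> P (f + g)) ->
  (forall f g, P f -> P g -> P (f * g)) ->
  forall f, P f.
Proof.
move=> PC PX PD PM f; rewrite [f]mpolyE.
apply: (big_ind P) => [|g h|m _]; [by rewrite -mpolyC0|exact: PD|].
rewrite -mul_mpolyC; apply: (PM) => //.
rewrite mpolyXE_id; apply: (big_ind P) => [|g h|i _]; [exact: PC 1|exact: (PM)|].
elim: (m i) => [|k IH]; first exact: PC 1.
by rewrite exprS; apply: PM.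
Qed.

Lemma pullback_retract W V (g : 'Hom(W, V)) (h : 'Hom(V, W)) :
  (h \o g = \1)%VF -> cancel (pullback h) (pullback g).
Proof.
move=> hg; elim/mpoly_closure_ind => [c|i|f1 f2 E1 E2|f1 f2 E1 E2].
- by rewrite /pullback !comp_mpolyC.
- by rewrite pullbackX pullback_form -comp_lfunA hg comp_lfun1r form_poly_coord.
- by rewrite !rmorphD /= E1 E2.
- by rewrite !rmorphM /= E1 E2.
Qed.

End PolynomialPullback.

(** * Derivations of a polynomial ring *)

Section Derivations.
Variables (R : realType) (n : nat).
Implicit Types th : {mpoly R[n]} -> {mpoly R[n]}.

Section Basics.
Variable theta : {mpoly R[n]} -> {mpoly R[n]}.
Hypothesis dth : derivation theta.

Lemma derivation0 : theta 0 = 0.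
Proof.
have /(_ (-1) 0 0) := dth.1; rewrite scaler0 addr0 => {1}->.
by rewrite scaleN1r addNr.
Qed.

Lemma derivationD f g : theta (f + g) = theta f + theta g.
Proof. by have := dth.1 1 f g; rewrite !scale1r. Qed.

Lemma derivationZ k f : theta (k *: f) = k *: theta f.
Proof. by have := dth.1 k f 0; rewrite !addr0 derivation0 addr0. Qed.

Lemma derivationC c : theta c%:MP = 0.
Proof.
rewrite -[c%:MP]mulr1 mul_mpolyC derivationZ.
have := dth.2 1 1; rewrite !mulr1 mul1r => /eqP.
by rewrite -subr_eq subrr => /eqP <-; rewrite scaler0.
Qed.

Lemma derivation_sum (I : Type) (r : seq I) (F : I -> {mpoly R[n]}) :
  theta (\sum_(i <- r) F i) = \sum_(i <- r) theta (F i).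
Proof.
elim: r => [|i r IH]; first by rewrite !big_nil derivation0.
by rewrite !big_cons derivationD IH.
Qed.

End Basics.

Lemma derivation_ext th1 th2 : derivation th1 -> derivation th2 ->
  (forall i, th1 'X_i = th2 'X_i) -> th1 =1 th2.
Proof.
move=> d1 d2 X12; elim/mpoly_closure_ind => [c|//|f g Ef Eg|f g Ef Eg].
- by rewrite !derivationC.
- by rewrite !derivationD // Ef Eg.
- by rewrite d1.2 d2.2 Ef Eg.
Qed.

Lemma derivation_comb (I : Type) (r : seq I) (c : I -> {mpoly R[n]})
    (th : I -> {mpoly R[n]} -> {mpoly R[n]}) :
  (forall i, derivation (th i)) ->
  derivation (fun f => \sum_(i <- r) c i * th i f).
Proof.
move=> dth; split=> [k f g|f g].
  rewrite scaler_sumr -big_split; apply: eq_bigr => i _ /=.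
  by rewrite (dth i).1 mulrDr scalerAr.
rewrite mulr_suml mulr_sumr -big_split; apply: eq_bigr => i _ /=.
by rewrite (dth i).2; ring.
Qed.

Lemma derivation_mderiv i : derivation (@mderiv n R i).
Proof. by split=> [k f g|f g]; rewrite ?linearP // mderivM. Qed.

End Derivations.

(** * Restriction to a hyperplane and bases of logarithmic derivations *)

Section HyperplaneRestriction.
Variables (R : realType) (V : vectType R) (a : 'Hom(V, R^o)).

(** The pullback along [incl] restricts polynomials to [X]; since [retr] is a left inverse of
    [incl], the pullback along [retr] is a section of it. *)
Definition incl (X : {vspace V}) : 'Hom(subvs_of X, V) := linfun vsval.
Definition retr (X : {vspace V}) : 'Hom(V, subvs_of X) := linfun (vsproj X).

Lemma inclE X w : incl X w = vsval w. Proof. by rewrite lfunE. Qed.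

Lemma retr_incl X : (retr X \o incl X = \1)%VF.
Proof. by apply/lfunP => w; rewrite comp_lfunE !lfunE /= vsvalK. Qed.

Lemma incl_retr (X : {vspace V}) v : v \in X -> incl X (retr X v) = v.
Proof. by move=> vX; rewrite !lfunE /= vsprojK. Qed.

Lemma comp_incl_eq0 (X : {vspace V}) (b : 'Hom(V, R^o)) :
  (b \o incl X = 0)%VF <-> (X <= lker b)%VS.
Proof.
split=> [b0|/subvP Xb].
  apply/subvP => v vX; rewrite memv_ker -(incl_retr vX) -comp_lfunE b0.
  by rewrite zero_lfunE.
apply/lfunP => w; rewrite comp_lfunE inclE zero_lfunE; apply/eqP.
by rewrite -memv_ker Xb // subvsP.
Qed.

Let H := lker a.

(** A linear form changes by a form vanishing on [H], hence by a multiple of [a]. Products follow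
    from f1 f2 - g1 g2 = (f1 - g1) f2 + g1 (f2 - g2). *)
Lemma pullback_section f :
  divides (form_poly a) (f - pullback (retr H) (pullback (incl H) f)).
Proof.
elim/mpoly_closure_ind: f => [c|i|f1 f2 E1 E2|f1 f2 E1 E2].
- by rewrite /pullback !comp_mpolyC subrr; apply: divides0.
- have -> : pullback (retr H) (pullback (incl H) 'X_i) =
      form_poly ((coord_form i \o incl H) \o retr H)%VF.
    by rewrite pullbackX pullback_form.
  set c' := ((coord_form i \o incl H) \o retr H)%VF.
  rewrite -[X in X - _](form_poly_coord i); set c := coord_form i.
  rewrite -form_polyB.
  have [|k ->] := @lker_sub_scale _ _ a (c - c').
    apply/subvP => v va; rewrite memv_ker add_lfunE opp_lfunE !comp_lfunE.
    by rewrite incl_retr // subrr.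
  by exists k%:MP; rewrite linearZ /= mulrC mul_mpolyC.
- rewrite !rmorphD /=; move: E1 E2; set g1 := pullback _ _; set g2 := pullback _ _.
  move=> [q1 E1] [q2 E2]; exists (q1 + q2).
  rewrite mulrDr -E1 -E2; ring.
- rewrite !rmorphM /=; move: E1 E2; set g1 := pullback _ _; set g2 := pullback _ _.
  move=> [q1 E1] [q2 E2]; exists (q1 * f2 + g1 * q2).
  rewrite mulrDr mulrA -E1 mulrCA -E2; ring.
Qed.

Lemma divides_form_pullback f :
  divides (form_poly a) f <-> pullback (incl H) f = 0.
Proof.
split=> [[q ->]|f0]; last first.
  by have := pullback_section f; rewrite f0 rmorph0 subr0.
rewrite rmorphM /= pullback_form.
by rewrite (_ : (a \o incl H)%VF = 0) ?linear0 ?mul0r //; apply/comp_incl_eq0.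
Qed.

(** By [divides_form_pullback] the quotient by the form embeds into the polynomial ring on [H],
    which is a domain. *)
Lemma form_poly_prime : a != 0 ->
  prime_elt (form_poly a) /\ ~ divides (form_poly a) 1.
Proof.
move=> a0; split; last first.
  by move/divides_form_pullback; rewrite rmorph1 => /eqP; rewrite oner_eq0.
split=> [|x y]; first by apply: contra_neq a0; apply: form_poly_eq0.
move/divides_form_pullback; rewrite rmorphM /= => /eqP.
by rewrite mulf_eq0 => /orP[]/eqP/divides_form_pullback; [left|right].
Qed.

Lemma form_poly_ndivides b :
  b != 0 -> lker a != lker b -> ~ divides (form_poly a) (form_poly b).
Proof.
move=> b0 + /divides_form_pullback; rewrite pullback_form => + /form_poly_eq0.
rewrite comp_incl_eq0 => + /lker_sub_scale[c bE].
rewrite bE; have c0 : c != 0 by apply: contra_neq b0; rewrite bE => ->; rewrite scale0r.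
case/eqP; apply/vspaceP => v; rewrite !memv_ker lfunE /=.
by rewrite -[c *: _]/(c * _) mulf_eq0 (negbTE c0).
Qed.

End HyperplaneRestriction.

Lemma perm_map_lift (T T' : eqType) (d : T -> T') (s : seq T) (e : seq T') :
  perm_eq e (map d s) -> exists2 t, perm_eq t s & e = map d t.
Proof.
elim: e s => [|x e IH] s eP.
  exists [::] => //; move: (perm_size eP); rewrite size_map /=.
  by move/esym/size0nil ->.
have /mapP[i si xE] : x \in map d s by rewrite -(perm_mem eP) mem_head.
have [|t tP eE] := IH (rem i s).
  rewrite -(perm_cons x) (perm_trans eP) // xE -map_cons.
  exact: perm_map (perm_to_rem si).
exists (i :: t); last by rewrite /= xE eE.
by rewrite perm_sym (perm_trans (perm_to_rem si)) // perm_cons perm_sym.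
Qed.

Section FreeBasis.
Variables (R : realType) (V : vectType R).
Notation S := {mpoly R[\dim {:V}]}.
Implicit Types (A : set {vspace V}) (I : finType).

(** The freeness condition over an arbitrary finite index type, so that single basis elements can be
    replaced without renumbering. *)
Definition free_basis A I (d : I -> nat) (theta : I -> S -> S) : Prop :=
  [/\ forall i, log_derivation A (theta i),
      forall i j, theta i 'X_j \is (d i).-homog
    & forall eta, log_derivation A eta ->
        exists! c : {ffun I -> S}, forall f, eta f = \sum_i c i * theta i f].

Lemma free_basis_exponents A I (d : I -> nat) theta e :
  free_basis A d theta -> perm_eq e (codom d) -> free_with_exponents A e.
Proof.
move=> [logth homth genth] /perm_map_lift[t tP ->].
have sz : size (map d t) = size t := size_map d t.
pose f (k : 'I_(size (map d t))) := tnth (in_tuple t) (cast_ord sz k).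
have ut : uniq t by rewrite (perm_uniq tP) enum_uniq.
have it i : i \in t by rewrite (perm_mem tP) mem_enum.
pose g i : 'I_(size (map d t)) :=
  cast_ord (esym sz) (Ordinal (etrans (index_mem i t) (it i))).
have gK : cancel g f.
  by move=> i; rewrite /f (tnth_nth i) /= nth_index.
have fK : cancel f g.
  move=> k; apply/val_inj => /=; have i0 := f k.
  by rewrite /f (tnth_nth i0) /= index_uniq // -sz.
have bf : bijective f by exists g.
exists (theta \o f); split=> [k|k j|eta logeta]; first exact: logth.
  rewrite (nth_map (f k)) -?sz //=.
  have -> : nth (f k) t k = f k; last exact: homth.
  by rewrite [in RHS]/f (tnth_nth (f k)).
have [c [cE cU]] := genth eta logeta.
exists [ffun k => c (f k)]; split=> [p|c' c'E].
  rewrite cE (reindex f) /=; last exact: onW_bij.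
  by apply: eq_bigr => k _; rewrite ffunE.
have -> : c = [ffun i => c' (g i)].
  apply: cU => p; rewrite c'E [RHS](reindex f) /=; last exact: onW_bij.
  by apply: eq_bigr => k _; rewrite ffunE fK.
by apply/ffunP => k; rewrite !ffunE fK.
Qed.

Lemma log_derivation_set0 eta : log_derivation (set0 : set {vspace V}) eta
  <-> derivation eta.
Proof. by split=> [[]//|]; split. Qed.

(** The partial derivatives, homogeneous of degree 0, form a basis; the coefficients of [eta] are
    its values on the variables. *)
Lemma free_set0 :
  free_with_exponents (set0 : set {vspace V}) (nseq (\dim {:V}) 0%N).
Proof.
have XE i j : ('X_j : S)^`M(i) = (j == i)%:R.
  rewrite mderivX mnm1E; case: eqP => [->|_]; last by rewrite scale0r.
  rewrite scale1r (_ : (_ - _)%MM = 0%MM) ?mpolyX0 //.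
  by apply/mnmP => k; rewrite mnmBE subnn mnm0E.
apply: (@free_basis_exponents _ 'I_(\dim {:V}) (fun=> 0%N)
  (fun i => @mderiv _ _ i)); last first.
  rewrite codomE -[X in nseq X _](size_enum_ord (\dim {:V})).
  by elim: (enum _) => //= i r; rewrite perm_cons.
split=> [i|i j|eta /log_derivation_set0 deta].
- by apply/log_derivation_set0/derivation_mderiv.
- by rewrite XE; case: (j == i); rewrite ?dhomog1 ?rpred0.
- exists [ffun i => eta 'X_i]; split=> [f|c' c'E].
    pose eta' f := \sum_i eta 'X_i * f^`M(i).
    rewrite (derivation_ext deta (th2 := eta')) //.
    + by apply: eq_bigr => i _; rewrite ffunE.
    + by apply: derivation_comb => i; apply: derivation_mderiv.
    + move=> i; rewrite /eta' (bigD1 i) //= XE eqxx mulr1 big1 ?addr0 // => j ji.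
      by rewrite XE eq_sym (negbTE ji) mulr0.
  apply/ffunP => i; rewrite ffunE c'E (bigD1 i) //= XE eqxx mulr1.
  by rewrite big1 ?addr0 // => j ji; rewrite XE eq_sym (negbTE ji) mulr0.
Qed.

Lemma free_with_exponents_perm A e e' :
  free_with_exponents A e -> perm_eq e' e -> free_with_exponents A e'.
Proof.
move=> [th thP] ee'.
apply: (@free_basis_exponents _ 'I_(size e) (fun i => nth 0%N e i) th) => //.
apply: perm_trans ee' _; rewrite codomE -[X in perm_eq X _](mkseq_nth 0%N e).
by rewrite /mkseq -val_enum_ord -map_comp.
Qed.

End FreeBasis.

(** * Homogeneous components of products *)

Section HomogeneousComponents.
Variables (R : realType) (n : nat).
Implicit Types p q : {mpoly R[n]}.

Lemma pihomogM d k p q : p \is d.-homog ->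
  pihomog mdeg (d + k) (p * q) = p * pihomog mdeg k q.
Proof.
move=> pd; set N := maxn (msize q) k.+1.
have qN : (msize q <= N)%N by rewrite leq_maxl.
have kN : (k < N)%N by rewrite leq_maxr.
rewrite {1}(pihomog_partitionE qN) mulr_sumr linear_sum (bigD1 (Ordinal kN)) //=.
have pM j : p * pihomog mdeg j q \is (d + j).-homog.
  by apply: dhomogM => //; apply: pihomogP.
rewrite pihomog_dE // big1 ?addr0 // => j jk.
rewrite (pihomog_ne0 _ (pM j)) // eqn_add2l.
by apply: contra_neq jk => jk; apply/val_inj.
Qed.

Lemma pihomogM_lt d k p q : p \is d.-homog -> (k < d)%N ->
  pihomog mdeg k (p * q) = 0.
Proof.
move=> pd kd; rewrite {1}(pihomog_partitionE (leqnn (msize q))).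
rewrite mulr_sumr linear_sum big1 // => j _.
have pM : p * pihomog mdeg j q \is (d + j).-homog.
  by apply: dhomogM => //; apply: pihomogP.
by rewrite /= (pihomog_ne0 _ pM) //; lia.
Qed.

Lemma dhomog0_const p : p \is 0.-homog -> p = (p@_0%MM)%:MP.
Proof.
move=> p0; apply/mpolyP => m; rewrite mcoeffC; have [->|m0] := eqVneq m 0%MM.
  by rewrite mulr1.
by rewrite mulr0 (dhomog_nemf_coeff p0) // mdeg_eq0.
Qed.

(** The component of [q] in degree [k - d] gives the same product. For [k < d] the subtraction is
    truncated, so the vanishing is recorded separately. *)
Lemma homog_cofactor d k p q : p \is d.-homog -> p * q \is k.-homog ->
  exists q', [/\ p * q' = p * q, q' \is (k - d).-homog & (k < d)%N -> q' = 0].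
Proof.
move=> pd pqk; have pqE := pihomog_dE pqk; have [kd|dk] := ltnP k d.
  exists 0; rewrite mulr0 rpred0 -{1}pqE.
  by rewrite (pihomogM_lt _ pd).
exists (pihomog mdeg (k - d) q); split; last by [].
  by rewrite -(pihomogM _ _ pd) subnKC.
exact: pihomogP.
Qed.

End HomogeneousComponents.

(** * Logarithmic derivations and their restriction to a hyperplane *)

Section LogDerivations.
Variables (R : realType) (V : vectType R).
Notation S := {mpoly R[\dim {:V}]}.
Implicit Types (A : set {vspace V}) (a b : 'Hom(V, R^o)) (th : S -> S).

Lemma log_derivationP A th : (forall K, A K -> (\dim K).+1 = \dim {:V}) ->
  log_derivation A th <-> derivation th /\
    forall K, A K -> exists a, [/\ a != 0, lker a = K &
       divides (form_poly a) (th (form_poly a))].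
Proof.
move=> Acodim; split=> -[dth logth]; split=> // K.
  move=> AK; have [a [a0 aK]] := hyperplane_lker (Acodim K AK).
  by exists a; split=> //; apply: logth aK.
move=> b AK bK; have [a [_ aK aP]] := logth K AK.
have [|c ->] := @lker_sub_scale _ _ a b; first by rewrite aK bK.
rewrite linearZ /= derivationZ //; have [g ->] := aP.
by exists g; rewrite scalerAl.
Qed.

Lemma log_derivation_comb A (I : Type) (r : seq I) (c : I -> S)
    (th_ : I -> S -> S) :
  (forall i : I, log_derivation A (th_ i)) ->
  log_derivation A (fun f => \sum_(i <- r) c i * th_ i f).
Proof.
move=> logth; split=> [|K a AK aK].
  by apply: derivation_comb => i; apply: (logth i).1.
by apply: divides_sum => i; apply: dividesMl; apply: (logth i).2 aK.
Qed.

Lemma derivation_form_homog th d a : derivation th ->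
  (forall j, th 'X_j \is d.-homog) -> th (form_poly a) \is d.-homog.
Proof.
move=> dth hth; rewrite derivation_sum //; apply: rpred_sum => i _.
by rewrite derivationZ //; apply: rpredZ.
Qed.

Lemma divides_scale (c : R) (p q : S) : c != 0 ->
  divides p (c *: q) -> divides p q.
Proof.
move=> c0 [g gE]; exists (c^-1 *: g).
by rewrite -scalerAr -gE scalerA mulVf // scale1r.
Qed.

End LogDerivations.

Section Restriction.
Variables (R : realType) (V : vectType R) (a : 'Hom(V, R^o)).
Notation S := {mpoly R[\dim {:V}]}.
Notation H := (lker a).
Notation rho := (pullback (incl H)).
Notation iota := (pullback (retr H)).
Implicit Types (th : S -> S) (K : {vspace V}).

Definition restr (X K : {vspace V}) : {vspace (subvs_of X)} := (incl X @^-1: K)%VS.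

Lemma restr_lker (X : {vspace V}) (b : 'Hom(V, R^o)) :
  lker (b \o incl X)%VF = restr X (lker b).
Proof.
by apply/vspaceP => w; rewrite -memv_preim !memv_ker comp_lfunE.
Qed.

Lemma pullback_retrK : cancel iota rho.
Proof. exact: pullback_retract (retr_incl _). Qed.

(** On [H] the form [c] is a multiple of [b], and a form vanishing on [H] is a multiple of [a]; so
    hyperplanes with the same trace on [H] lie in a pencil with [H]. *)
Lemma restr_eq_form (b c : 'Hom(V, R^o)) :
  (restr H (lker b) <= restr H (lker c))%VS ->
  exists k l : R, c = k *: b + l *: a.
Proof.
rewrite -!restr_lker => /lker_sub_scale[k kE].
have [|l lE] := @lker_sub_scale _ _ a (c - k *: b).
  apply/comp_incl_eq0; rewrite comp_lfunDl kE comp_lfunNl comp_lfunZl.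
  exact: subrr.
by exists k, l; rewrite -lE addrC subrK.
Qed.

Lemma restr_section_form (b : 'Hom(V, R^o)) (c : 'Hom(subvs_of H, R^o)) :
  restr H (lker b) = lker c ->
  exists k l : R, c = k *: (b \o incl H)%VF /\
    (c \o retr H)%VF = k *: b + l *: a.
Proof.
rewrite -restr_lker => bc; have [|k kE] := @lker_sub_scale _ _ (b \o incl H)%VF c.
  by rewrite bc.
have [|l lE] := @lker_sub_scale _ _ a ((c \o retr H)%VF - k *: b).
  apply/comp_incl_eq0; rewrite comp_lfunDl -comp_lfunA retr_incl comp_lfun1r.
  by rewrite comp_lfunNl -comp_lfunZl kE subrr.
by exists k, l; split=> //; rewrite -lE addrC subrK.
Qed.

(** When [th] maps the form of [H] into its own ideal, it induces a derivation on [H], computed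
    through the section [iota]. A form on [H] extends to [k *: b + l *: a]; the value on the second
    term vanishes on [H], and the value on [b] stays divisible by [b]. *)
Lemma log_derivation_restriction (A : set {vspace V}) th :
  (forall K, A K -> (\dim K).+1 = \dim {:V}) ->
  log_derivation (A `\ H)%classic th -> rho (th (form_poly a)) = 0 ->
  log_derivation (restriction A H) (fun f => rho (th (iota f))).
Proof.
move=> Acodim [dth logth] tha; split.
  split=> [k f g|f g].
    by rewrite linearP dth.1 linearP.
  by rewrite rmorphM dth.2 rmorphD !rmorphM /= !pullback_retrK.
move=> Y c [K [AK HK] KY] cY.
have [b [b0 bK]] := hyperplane_lker (Acodim K AK).
have [k [l [cE crE]]] : exists k l : R, c = k *: (b \o incl H)%VF /\
    (c \o retr H)%VF = k *: b + l *: a.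
  by apply: restr_section_form; rewrite bK cY -KY.
have [|g gE] := logth K b _ bK.
  by split=> // KH; move: HK; rewrite KH subvv.
rewrite pullback_form crE linearD !linearZ /= (derivationD dth) !(derivationZ dth).
rewrite linearD !linearZ /= tha scaler0 addr0 gE rmorphM /= pullback_form.
by exists (rho g); rewrite cE linearZ /= scalerAl.
Qed.

End Restriction.

(** * The addition theorem *)

Section AdditionTheorem.
Variables (R : realType) (V : vectType R) (a : 'Hom(V, R^o)).
Notation S := {mpoly R[\dim {:V}]}.
Notation H := (lker a).
Notation T := {mpoly R[\dim {:subvs_of H}]}.
Notation rho := (pullback (incl H)).
Notation iota := (pullback (retr H)).

Variables (A : set {vspace V}) (sA : seq {vspace V})
  (sR : seq {vspace (subvs_of H)}).
Variables (fm : {vspace V} -> 'Hom(V, R^o))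
  (gm : {vspace (subvs_of H)} -> 'Hom(subvs_of H, R^o)).

Hypotheses (a0 : a != 0) (AH : A H)
  (Acodim : forall K, A K -> (\dim K).+1 = \dim {:V})
  (fmP : forall K, A K -> fm K != 0 /\ lker (fm K) = K)
  (usA : uniq sA) (sAP : forall K, K \in sA <-> (A `\ H)%classic K)
  (usR : uniq sR) (sRP : forall Y, Y \in sR <-> restriction A H Y)
  (gmP : forall Y, Y \in sR -> gm Y != 0 /\ lker (gm Y) = Y).

Lemma deletion_nsub K : K \in sA -> ~~ (H <= K)%VS.
Proof.
move=> /sAP[AK KH]; apply/negP => HK; apply: KH.
by apply/esym/eqP; rewrite eqEdim HK /= -ltnS (Acodim AH) -(Acodim AK).
Qed.

Lemma restr_deletion K : K \in sA -> restr H K \in sR.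
Proof.
by move=> Ks; apply/sRP; exists K => //; split; [case/sAP: Ks | apply: deletion_nsub].
Qed.

Lemma restr_onto Y : Y \in sR -> exists2 K, K \in sA & restr H K = Y.
Proof.
move/sRP=> [K [AK HK] KY]; exists K => //; apply/sAP; split=> // KH.
by move: HK; rewrite KH subvv.
Qed.

Notation fibre := (fun Y => [seq K <- sA | restr H K == Y]).

Lemma size_fibre_gt0 Y : Y \in sR -> (0 < size (fibre Y))%N.
Proof.
move=> /restr_onto[K Ks KY]; have : K \in fibre Y by rewrite mem_filter KY eqxx.
by case: (fibre Y).
Qed.

(** Every hyperplane of the deletion lies over exactly one hyperplane of the restriction, and no
    fibre is empty. *)
Lemma sum_size_fibre : \sum_(Y <- sR) (size (fibre Y)).-1 = (size sA - size sR)%N.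
Proof.
have E : \sum_(Y <- sR) size (fibre Y) = size sA.
  under eq_bigr => Y _ do rewrite size_filter -sum1_count big_mkcond.
  rewrite exchange_big /= -sum1_size !big_seq; apply: eq_bigr => K Ks.
  rewrite -big_mkcond sum1_count -(eq_count (a1 := pred1 (restr H K))).
    by rewrite count_uniq_mem // restr_deletion.
  by move=> Y; rewrite /= eq_sym.
suff : (\sum_(Y <- sR) (size (fibre Y)).-1 + size sR)%N = size sA.
  by move=> <-; rewrite addnK.
rewrite -E -sum1_size -big_split /= !big_seq; apply: eq_bigr => Y Ys.
by rewrite addn1 prednK // size_fibre_gt0.
Qed.

Lemma form_fm_prime K : K \in sA ->
  prime_elt (form_poly (fm K)) /\ ~ divides (form_poly (fm K)) 1.
Proof. by move=> /sAP[/fmP[+ _] _]; apply: form_poly_prime. Qed.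

(* With x, y the forms of H and of one hyperplane K1 over Y, the polynomial
   y th(x) - x th(y) is divisible by the form of every hyperplane over Y. *)
Lemma restr_value_divisible_fibre th Y :
  log_derivation (A `\ H)%classic th -> Y \in sR ->
  divides (form_poly (gm Y) ^+ (size (fibre Y)).-1) (rho (th (form_poly a))).
Proof.
move=> [dth logth] Ys; set x := form_poly a.
have [g0 gY] := gmP Ys.
have fP K : K \in fibre Y -> K \in sA /\ restr H (lker (fm K)) = Y.
  rewrite mem_filter => /andP[/eqP KY Ks]; split=> //.
  by have /sAP[/fmP[_ ->] _] := Ks.
have rhoform K : K \in fibre Y ->
    exists2 k : R, k != 0 & rho (form_poly (fm K)) = k *: form_poly (gm Y).
  move=> /fP[Ks KY]; have [|k kE] := @lker_sub_scale _ _ (gm Y) (fm K \o incl H)%VF.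
    by rewrite restr_lker KY gY.
  exists k; last by rewrite pullback_form kE linearZ.
  apply/eqP => k0; have := deletion_nsub Ks; have /sAP[/fmP[_ <-] _] := Ks.
  by apply/negP; rewrite negbK; apply/comp_incl_eq0; rewrite kE k0 scale0r.
have := size_fibre_gt0 Ys; case fY: (fibre Y) => [//|K1 s] _.
have K1f : K1 \in fibre Y by rewrite fY mem_head.
have [K1s K1Y] := fP _ K1f; set y := form_poly (fm K1).
have divE K : K \in fibre Y -> divides (form_poly (fm K)) (y * th x - x * th y).
  move=> Kf; have [Ks KY] := fP _ Kf.
  have [k [l kl]] : exists k l : R, fm K = k *: fm K1 + l *: a.
    by apply: restr_eq_form; rewrite K1Y KY subvv.
  have k0 : k != 0.
    apply: contraNneq (deletion_nsub Ks) => k0.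
    have /sAP[/fmP[_ <-] _] := Ks; rewrite kl k0 scale0r add0r.
    by apply/subvP => v; rewrite !memv_ker scale_lfunE => /eqP ->; rewrite scaler0.
  have [g gE] : divides (form_poly (fm K)) (th (form_poly (fm K))).
    by apply: (logth K); [exact/sAP | have /sAP[/fmP[_ ->] _] := Ks].
  (* With f = k y + l x the terms in l cancel: k (y th(x) - x th(y)) = f th(x) - x th(f), and th(f)
     = f g. *)
  apply: (divides_scale k0); exists (th x - x * g).
  have fE : form_poly (fm K) = k *: y + l *: x by rewrite kl linearD !linearZ.
  have : th (form_poly (fm K)) = k *: th y + l *: th x.
    by rewrite fE (derivationD dth) !(derivationZ dth).
  rewrite gE => /eqP; rewrite -subr_eq => /eqP thy.
  rewrite scalerBr scalerAl scalerAr -thy fE -!mul_mpolyC; ring.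
have [q qE] : divides (\prod_(K <- fibre Y) form_poly (fm K) ^+ 1)
    (y * th x - x * th y).
  apply: (@prod_prime_pow_divides _ _ _ _ (fun=> 1%N)).
  - exact: filter_uniq.
  - by move=> K /fP[Ks _]; apply: form_fm_prime.
  - move=> K K' /fP[/sAP[/fmP[_ Kf] _] _] /fP[/sAP[/fmP[K'0 K'f] _] _] KK'.
    by apply: form_poly_ndivides => //; rewrite Kf K'f.
  - by move=> K Kf; rewrite expr1; apply: divE.
have [q' q'E] : divides (form_poly (gm Y) ^+ size (fibre Y))
    (rho (\prod_(K <- fibre Y) form_poly (fm K) ^+ 1)).
  rewrite rmorph_prod; have : {subset fibre Y <= fibre Y} by [].
  elim: {1 3 4}(fibre Y) => [|K r IH] rf; first by exists 1; rewrite big_nil mulr1.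
  have [k _ kE] := rhoform K (rf _ (mem_head _ _)).
  have [|g gE] := IH; first by move=> K' K'r; apply: rf; rewrite inE K'r orbT.
  exists (k *: g); rewrite big_cons gE expr1 /= kE exprS -scalerAl -scalerAr.
  by rewrite mulrA.
have [k k0 kE] := rhoform K1 K1f.
apply: (divides_scale k0); exists (q' * rho q).
have gn0 : form_poly (gm Y) != 0.
  by apply: contra_neq g0; apply: form_poly_eq0.
(* On [H] the form x vanishes and only y th(x) is left; y restricts to a nonzero multiple of the
   form of [Y], so one factor is cancelled and the exponent drops by 1. *)
apply: (mulfI gn0).
have /(congr1 rho) := qE; rewrite rmorphB !rmorphM /= q'E kE.
rewrite pullback_form (_ : (a \o incl H)%VF = 0); last by apply/comp_incl_eq0.
rewrite linear0 mul0r subr0 -scalerAl => E.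
by rewrite -scalerAr E fY /= exprS !mulrA.
Qed.

(** Terao's polynomial B, as a polynomial on [H]. A fibre contributes one factor less than its size,
    so the degree is |A \ {H}| - |A^H|. *)
Definition addition_divisor : T :=
  \prod_(Y <- sR) form_poly (gm Y) ^+ (size (fibre Y)).-1.

Lemma restr_value_divisible th : log_derivation (A `\ H)%classic th ->
  divides addition_divisor (rho (th (form_poly a))).
Proof.
move=> logth; apply: prod_prime_pow_divides => //.
- by move=> Y /gmP[Y0 _]; apply: form_poly_prime.
- move=> Y Y' /gmP[Y0 Yk] /gmP[Y'0 Y'k] YY'.
  by apply: form_poly_ndivides => //; rewrite Yk Y'k.
- by move=> Y; apply: restr_value_divisible_fibre.
Qed.

Lemma addition_divisor_homog :
  addition_divisor \is (size sA - size sR).-homog.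
Proof.
rewrite -sum_size_fibre /addition_divisor; elim: sR => [|Y r IH].
  by rewrite !big_nil dhomog1.
rewrite !big_cons; apply: dhomogM => //.
have := dhomogMn (size (fibre Y)).-1 (form_poly_homog (gm Y)).
by rewrite mul1n.
Qed.

End AdditionTheorem.

(** * Modifying a basis when a hyperplane is added *)

Section FreeAddition.
Variables (R : realType) (V : vectType R) (a : 'Hom(V, R^o)).
Notation S := {mpoly R[\dim {:V}]}.
Notation H := (lker a).
Notation rho := (pullback (incl H)).
Notation iota := (pullback (retr H)).
Variables (A : set {vspace V}).
Hypotheses (a0 : a != 0) (AH : A H)
  (Acodim : forall K, A K -> (\dim K).+1 = \dim {:V}).

Let rho_a : rho (form_poly a) = 0.
Proof. exact/divides_form_pullback/divides_refl. Qed.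

Lemma log_derivation_add th : log_derivation (A `\ H)%classic th ->
  rho (th (form_poly a)) = 0 -> log_derivation A th.
Proof.
move=> [dth logth] tha; apply/log_derivationP => //; split=> // K AK.
have [->|KH] := eqVneq K H.
  by exists a; split=> //; apply/divides_form_pullback.
have [b [b0 bK]] := hyperplane_lker (Acodim AK).
by exists b; split=> //; apply: (logth K) => //; split=> //; apply/eqP.
Qed.

Lemma log_derivation_delete th :
  log_derivation A th -> log_derivation (A `\ H)%classic th.
Proof. by move=> [dth logth]; split=> // K b [AK _]; apply: logth. Qed.

(** The pivot [th i0] is multiplied by the form of [H]; the others are corrected by multiples of the
    pivot so that their values on that form vanish on [H]. For [eta] in D(A) the product of the
    remaining pivot coefficient [e] and the value of [th i0] on the form then vanishes on [H], so
    the prime form divides [e]. *)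
Lemma free_basis_add (I : finType) (d : I -> nat) (th : I -> S -> S)
    (f : I -> S) (i0 : I) :
  free_basis (A `\ H)%classic d th -> rho (th i0 (form_poly a)) != 0 ->
  (forall j, [/\ f j \is (d j - d i0).-homog, (d j < d i0)%N -> f j = 0
     & rho (th j (form_poly a)) = rho (f j * th i0 (form_poly a))]) ->
  free_basis A (fun i => if i == i0 then (d i0).+1 else d i)
    (fun i p => if i == i0 then form_poly a * th i0 p
                else th i p - f i * th i0 p).
Proof.
move=> [logth homth genth] ti0 fP; set x := form_poly a.
have dth i : derivation (th i) by apply: (logth i).1.
have [px _] := form_poly_prime a0; rewrite -/x in px.
split=> [i|i j|eta logeta].
- case: (eqVneq i i0) => [_|ii0]; apply: log_derivation_add.
  + have := log_derivation_comb [:: tt] (fun=> x) (fun=> logth i0).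
    rewrite (_ : (fun p => \sum_(k <- _) _) = (fun p => x * th i0 p)) //.
    by apply/funext => p; rewrite big_seq1.
  + by rewrite rmorphM /= /x rho_a mul0r.
  + have := log_derivation_comb [:: i; i0]
      (fun k => if k == i0 then - f i else 1) logth.
    rewrite (_ : (fun p => \sum_(k <- _) _) = (fun p => th i p - f i * th i0 p)) //.
    apply/funext => p; rewrite big_cons big_seq1 eqxx (negbTE ii0).
    by rewrite mul1r mulNr.
  + by have [_ _ fE] := fP i; rewrite rmorphB /= fE subrr.
- case: eqVneq => [_|ii0].
    by rewrite -add1n; apply: dhomogM => //; apply: form_poly_homog.
  apply: rpredB => //; have [fh f0 _] := fP i.
  have [di|di] := ltnP (d i) (d i0); first by rewrite f0 // mul0r rpred0.
  by rewrite -(subnK di); apply: dhomogM.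
have [c [cE cU]] := genth _ (log_derivation_delete logeta).
set e := c i0 + \sum_(j | j != i0) c j * f j.
have etaE p : eta p = \sum_(j | j != i0) c j * (th j p - f j * th i0 p) + e * th i0 p.
  rewrite cE (bigD1 i0) //= /e mulrDl addrCA mulr_suml -big_split /=.
  congr (_ + _); apply: eq_bigr => j _; ring.
have [e' eE] : divides x e.
  have [|//|/divides_form_pullback tia] := px.2 e (th i0 x); last first.
    by rewrite tia eqxx in ti0.
  apply/divides_form_pullback.
  have /divides_form_pullback : divides x (eta x) by apply: (logeta.2 H).
  rewrite etaE rmorphD rmorph_sum big1 ?add0r // => j _.
  by have [_ _ fE] := fP j; rewrite rmorphM rmorphB /= fE subrr mulr0.
exists [ffun j => if j == i0 then e' else c j]; split=> [p|c' c'E].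
  rewrite etaE [RHS](bigD1 i0) //= ffunE eqxx eE addrC; congr (_ + _); last by ring.
  by apply: eq_bigr => j /negbTE jn; rewrite ffunE jn.
have cE' : c = [ffun j => if j == i0 then c' i0 * x - \sum_(k | k != i0) c' k * f k
                          else c' j].
  apply: cU => p; rewrite c'E (bigD1 i0) //= [RHS](bigD1 i0) //= ffunE !eqxx.
  rewrite mulrBl -addrA [X in - X + _]mulr_suml mulrA; congr (_ + _).
  rewrite addrC -sumrB; apply: eq_bigr => j /negbTE jn; rewrite jn ffunE jn; ring.
apply/ffunP => j; rewrite ffunE; case: eqP => [->|/eqP/negbTE jn]; last first.
  by rewrite cE' ffunE jn.
apply: (mulfI px.1); rewrite -eE /e cE' ffunE eqxx.
rewrite [X in _ + X](eq_bigr (fun k => c' k * f k)) => [|k /negbTE kn].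
  by rewrite /= subrK mulrC.
by rewrite ffunE kn.
Qed.

(** By homogeneity of [eta] and the [phi j], each coefficient can be replaced by its component of
    degree [k - d j]. *)
Lemma homog_coefficients (W : vectType R) (B : set {vspace W}) (J : finType)
    (d : J -> nat) phi eta k :
  free_basis B d phi -> log_derivation B eta ->
  (forall i, eta 'X_i \is k.-homog) ->
  exists c : J -> {mpoly R[\dim {:W}]},
    (forall j, (k < d j)%N -> c j = 0) /\
    forall p, eta p = \sum_j c j * phi j p.
Proof.
move=> [logphi homphi genphi] logeta hometa.
have [c [cE _]] := genphi _ logeta.
exists (fun j => if (k < d j)%N then 0 else pihomog mdeg (k - d j) (c j)).
split=> [j ->//|]; apply: derivation_ext => [||i].
- exact: logeta.1.
- by apply: derivation_comb => j; apply: (logphi j).1.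
rewrite -(pihomog_dE (hometa i)) cE linear_sum; apply: eq_bigr => j _ /=.
rewrite mulrC; case: ltnP => kd; first by rewrite mul0r (pihomogM_lt _ (homphi j i)).
by rewrite -{1}(subnKC kd) (pihomogM _ _ (homphi j i)) mulrC.
Qed.

(* A nontrivial relation between restrictions lifts to a combination of the
   th_i with values in the ideal of H; dividing by the form of H and expanding
   again in the basis shows that the relation was trivial. *)
Lemma restrictions_independent (I : finType) (d : I -> nat) (th : I -> S -> S)
    (u : I -> {mpoly R[\dim {:subvs_of H}]}) :
  free_basis (A `\ H)%classic d th ->
  \sum_i u i * rho (th i (form_poly a)) = 0 ->
  (forall p, \sum_i u i * rho (th i (iota p)) = 0) ->
  forall i, u i = 0.
Proof.
move=> [logth homth genth] ua u0.
have [[x0 px] _] := form_poly_prime a0.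
pose xi p := \sum_i iota (u i) * th i p.
have logxi : log_derivation (A `\ H)%classic xi.
  exact: log_derivation_comb.
have rxi p : rho (xi p) = \sum_i u i * rho (th i p).
  rewrite rmorph_sum; apply: eq_bigr => i _.
  by rewrite rmorphM /= pullback_retrK.
(* All values of [xi] lie in the ideal of [H], since [p] splits into a polynomial pulled back from
   [H] and a multiple of the form; [eta] is the quotient. *)
have /choice[eta etaE] p : divides (form_poly a) (xi p).
  have [q qE] := pullback_section a p.
  have -> : p = iota (rho p) + form_poly a * q by rewrite -qE addrC subrK.
  rewrite (derivationD logxi.1); apply: dividesD.
    by apply/divides_form_pullback; rewrite rxi.
  rewrite logxi.1.2; apply: dividesD; last by exists (xi q).
  by apply: dividesMr; apply/divides_form_pullback; rewrite rxi.
have logeta : log_derivation (A `\ H)%classic eta.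
  split=> [|K b AK bK].
    split=> [k p q|p q]; apply: (mulfI x0).
      by rewrite -etaE logxi.1.1 !etaE mulrDr scalerAr.
    rewrite -etaE logxi.1.2 !etaE; ring.
  have b0 : b != 0.
    apply/eqP => b0; have [AK' _] := AK; have := Acodim AK'.
    rewrite -bK b0 (_ : lker 0 = fullv); first by lia.
    by apply/vspaceP => v; rewrite memv_ker zero_lfunE eqxx memvf.
  have [[_ pb] _] := form_poly_prime b0.
  have [||//] := pb (form_poly a) (eta (form_poly b)).
    by rewrite -etaE; apply: (logxi.2 K).
  move=> /(form_poly_ndivides (b := a) a0) [].
  by rewrite bK; apply/eqP; case: AK.
have [c [cE _]] := genth _ logeta.
have [c' [_ cU]] := genth _ logxi.
have c1 : c' = [ffun i => iota (u i)].
  by apply: cU => p; apply: eq_bigr => i _; rewrite ffunE.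
have c2 : c' = [ffun i => form_poly a * c i].
  apply: cU => p; rewrite etaE cE mulr_sumr; apply: eq_bigr => i _.
  by rewrite ffunE mulrA.
move=> i; have E : iota (u i) = form_poly a * c i.
  by move: c1; rewrite c2 => /ffunP/(_ i); rewrite !ffunE.
by rewrite -[u i]pullback_retrK E rmorphM /= rho_a mul0r.
Qed.

End FreeAddition.

Section FreeAdditionTheorem.
Variables (R : realType) (V : vectType R).
Implicit Types (A : set {vspace V}) (H : {vspace V}).

Lemma perm_codom_replace (I : finType) (d : I -> nat) (i0 : I) k e :
  perm_eq (d i0 :: e) (codom d) ->
  perm_eq (k :: e) (codom (fun i => if i == i0 then k else d i)).
Proof.
have E (f : I -> nat) : perm_eq (codom f) (f i0 :: map f (rem i0 (enum I))).
  by rewrite codomE -map_cons perm_map // perm_to_rem // mem_enum.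
move=> ed; rewrite perm_sym (perm_trans (E _)) //= eqxx perm_cons perm_sym.
have := perm_trans ed (E d); rewrite perm_cons => /perm_trans; apply.
rewrite (_ : map _ _ = map d (rem i0 (enum I))) //.
apply/eq_in_map => i ir; case: eqP => // ii0.
by move: ir; rewrite ii0 mem_rem_uniq ?enum_uniq // inE eqxx.
Qed.

Lemma sum_pushforward (S : pzSemiRingType) (I J : finType)
    (f : J -> I) (u : J -> S) (X : I -> S) :
  \sum_i (\sum_(k | f k == i) u k) * X i = \sum_k u k * X (f k).
Proof.
under eq_bigr do rewrite mulr_suml.
rewrite (exchange_big_dep predT) //=; apply: eq_bigr => k _.
by rewrite (eq_bigl (pred1 (f k))) ?big_pred1_eq // => i; rewrite eq_sym.
Qed.

(** The restriction [P i] to [H] of the value of [th i] on the form of [H] is [B * q i], where [B]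
    has degree [b]. If some [P i] with [d i <= b] is nonzero, then [d i = b], [q i] is a nonzero
    constant, and [th i] is a pivot for [free_basis_add]. Otherwise all [th i] with [d i <= b]
    induce elements of D(A^H), which are combinations of the [phi j] with [dr j <= b]; there are
    more of the former than of the latter, and the resulting relation contradicts
    [restrictions_independent]. *)
Theorem free_addition A H (sA : seq {vspace V})
    (sR : seq {vspace (subvs_of H)}) (b : nat) (e : seq nat) :
  (forall K, A K -> (\dim K).+1 = \dim {:V}) -> A H ->
  uniq sA -> (forall K, K \in sA <-> (A `\ H)%classic K) ->
  uniq sR -> (forall Y, Y \in sR <-> restriction A H Y) ->
  size sA = (size sR + b)%N ->
  free_with_exponents (A `\ H)%classic (b :: e) ->
  free_with_exponents (restriction A H) e ->
  free_with_exponents A (b.+1 :: e).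
Proof.
move=> Acodim AH usA sAP usR + sz [th thP] [phi phiP].
have [a [a0 aH]] := hyperplane_lker (Acodim H AH).
move: AH sR usR sz sAP th thP phi phiP; rewrite -{}aH {H}.
move=> AH sR usR sz sAP th thP phi phiP sRP.
set H := lker a; set x := form_poly a.
pose d (i : 'I_(size (b :: e))) := nth 0%N (b :: e) i.
have {}thP : free_basis (A `\ H)%classic d th by exact: thP.
pose dr (j : 'I_(size e)) := nth 0%N e j.
have {}phiP : free_basis (restriction A H) dr phi by exact: phiP.
have /choice[fm fmP] K : exists f : 'Hom(V, R^o), A K -> f != 0 /\ lker f = K.
  have [/Acodim/hyperplane_lker[f fP]|nA] := pselect (A K); first by exists f.
  by exists 0.
have /choice[gm gmP] Y : exists g : 'Hom(subvs_of H, R^o),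
    Y \in sR -> g != 0 /\ lker g = Y.
  have [Ys|nY] := boolP (Y \in sR); last by exists 0.
  have /sRP[K [AK HK] KY] := Ys; have [f0 fK] := fmP K AK.
  exists (fm K \o incl H)%VF => _; split; last by rewrite restr_lker fK.
  by apply: contraNneq HK => /comp_incl_eq0; rewrite fK.
pose rho := pullback (incl H); pose iota := pullback (retr H).
pose B := addition_divisor sA sR gm.
have Bh : B \is b.-homog.
  rewrite (_ : b = (size sA - size sR)%N); last by rewrite sz addKn.
  exact: (addition_divisor_homog gm AH Acodim sAP usR sRP).
pose P i := rho (th i x).
have dth i : derivation (th i) by have [/(_ i)[]] := thP.
have hth i j : th i 'X_j \is (d i).-homog by have [_ /(_ i j)] := thP.
have Ph i : P i \is (d i).-homog.
  by apply: pullback_homog; apply: derivation_form_homog.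
have /choice[q qP] i : exists q, [/\ B * q = P i, q \is (d i - b).-homog &
    (d i < b)%N -> q = 0].
  have [q qE] : divides B (P i).
    apply: (restr_value_divisible AH Acodim fmP usA sAP usR sRP gmP).
    by have [/(_ i)] := thP.
  have := Ph i; rewrite qE => /(homog_cofactor Bh)[q' [q'E q'h q'0]].
  by exists q'; rewrite q'E.
have [/existsP[i0 /andP[di0 Pi0]]|] := boolP [exists i, (d i <= b)%N && (P i != 0)].
  have [qE qh q0] := qP i0.
  have di0b : d i0 = b.
    apply/eqP; rewrite eqn_leq di0 leqNgt; apply: contraNN Pi0 => /q0 qi0.
    by rewrite -qE qi0 mulr0.
  move: qh; rewrite di0b subnn => /dhomog0_const; set c := mcoeff _ _ => qc.
  have c0 : c != 0.
    by apply: contraNneq Pi0 => c0; rewrite -qE qc c0 mpolyC0 mulr0.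
  (* Since [P i0] is the constant [c] times [B], subtracting [q j / c] times the pivot kills
     [P j]. *)
  have := free_basis_add a0 AH Acodim (f := fun j => iota (c^-1 *: q j)) thP Pi0.
  move=> /(_ _)/free_basis_exponents; apply; last first.
    rewrite -[b.+1]/(S b) -di0b.
    apply: perm_codom_replace; rewrite di0b codomE /d.
    rewrite -[X in perm_eq X _](mkseq_nth 0%N (b :: e)).
    by rewrite /mkseq -val_enum_ord -map_comp.
  move=> j; have [qjE qjh qj0] := qP j; rewrite di0b; split.
  - by apply: pullback_homog; apply: rpredZ.
  - by move=> /qj0 ->; rewrite /iota scaler0 rmorph0.
  - rewrite rmorphM /= /iota pullback_retrK -/x -/rho -/(P j) -/(P i0) -qjE -qE qc.
    rewrite -scalerAl [q j * _]mulrC -mulrA mul_mpolyC -scalerAr scalerA.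
    by rewrite mulVf // scale1r.
rewrite negb_exists => /forallP nP; exfalso.
have P0 i : (d i <= b)%N -> P i = 0.
  by move=> di; apply/eqP; have := nP i; rewrite di /= negbK.
have /choice[c cP] i : exists c : 'I_(size e) -> {mpoly R[\dim {:subvs_of H}]},
    (d i <= b)%N -> (forall j, (b < dr j)%N -> c j = 0) /\
      forall p, rho (th i (iota p)) = \sum_j c j * phi j p.
  have [di|ndi] := leqP (d i) b; last by exists (fun=> 0).
  have [||c [c0 cE]] := homog_coefficients (k := d i)
    (eta := fun p => rho (th i (iota p))) phiP.
  - apply: log_derivation_restriction => //; last exact: P0.
    by have [/(_ i)] := thP.
  - move=> j; rewrite /iota pullbackX; apply: pullback_homog.
    exact: derivation_form_homog.
  by exists c => _; split=> // j bj; apply: c0; apply: leq_ltn_trans di bj.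
pose J := [seq j <- enum 'I_(size e) | (dr j <= b)%N].
pose I := [seq i <- enum 'I_(size (b :: e)) | (d i <= b)%N].
have count_le (s : seq nat) :
    size [seq i : 'I_(size s) <- enum 'I_(size s) | (nth 0%N s i <= b)%N] =
    count (fun k => (k <= b)%N) s.
  rewrite size_filter -[in RHS](mkseq_nth 0%N s) /mkseq -val_enum_ord.
  by rewrite -map_comp count_map.
(* The lists [b :: e] and [e] differ by the entry [b], which itself satisfies the bound. *)
have szI : size I = (size J).+1 by rewrite !count_le /= leqnn.
pose fI (k : 'I_(size J).+1) := tnth (in_tuple I) (cast_ord (esym szI) k).
pose fJ (k : 'I_(size J)) := tnth (in_tuple J) k.
have fI_inj : injective fI.
  move=> k1 k2; rewrite /fI !(tnth_nth ord0) /= => /eqP.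
  have uI : uniq I by rewrite filter_uniq ?enum_uniq.
  rewrite (nth_uniq _ _ _ uI) ?szI ?ltn_ord //.
  by move=> /eqP/val_inj.
have fIb i : (d (fI i) <= b)%N.
  have := mem_tnth (cast_ord (esym szI) i) (in_tuple I).
  by rewrite mem_filter => /andP[].
have [u [[k0 uk0] uc]] := rows_dependent (fun i j => c (fI i) (fJ j)).
pose u' i := \sum_(k | fI k == i) u k.
have u'0 : forall i, u' i = 0.
  apply: (restrictions_independent (u := u') a0 Acodim thP).
    rewrite sum_pushforward // big1 // => k _.
    by rewrite [X in _ * X](P0 _ (fIb k)) mulr0.
  move=> p; rewrite sum_pushforward //.
  under eq_bigr => k _ do rewrite [X in _ * X](cP _ (fIb k)).2 mulr_sumr.
  rewrite exchange_big big1 //= => j _.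
  under eq_bigr => k _ do rewrite mulrA.
  rewrite -mulr_suml; have [dj|dj] := leqP (dr j) b; last first.
    by rewrite big1 ?mul0r // => k _; rewrite (cP _ (fIb k)).1 // mulr0.
  have jJ : j \in J by rewrite mem_filter dj mem_enum.
  have /tnthP[j' ->] : j \in in_tuple J by [].
  by rewrite (uc j') mul0r.
move: uk0; rewrite -(u'0 (fI k0)) /u' (eq_bigl (pred1 k0)).
  by rewrite big_pred1_eq eqxx.
by move=> k; rewrite /= (inj_eq fI_inj).
Qed.

End FreeAdditionTheorem.

(** * Inductively free arrangements with exponents *)

Local Open Scope classical_set_scope.

Section InductiveExponents.
Variable R : realType.
Implicit Types V : vectType R.

(* The last clause, |A| = e_1 + ... + e_N, gives the degree |A'| - |A''| that
   the addition theorem needs. *)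
Definition inductive_exponents V (A : set {vspace V}) (e : seq nat) : Prop :=
  [/\ arrangement A, inductively_free A, free_with_exponents A e
    & exists s : seq {vspace V},
        [/\ uniq s, forall K, K \in s <-> A K & size s = sumn e]].

Lemma inductive_exponents_perm V (A : set {vspace V}) e e' :
  inductive_exponents A e -> perm_eq e' e -> inductive_exponents A e'.
Proof.
move=> [arrA indA freeA [s [us sP ss]]] ee'; split=> //.
  exact: free_with_exponents_perm ee'.
by exists s; split=> //; rewrite ss; apply: perm_sumn; rewrite perm_sym.
Qed.

Lemma inductive_exponents0 V :
  inductive_exponents (set0 : set {vspace V}) (nseq (\dim {:V}) 0%N).
Proof.
split; first by split.
- exact: inductively_free_empty.
- exact: free_set0.
- by exists [::]; split=> //; rewrite sumn_nseq mul0n.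
Qed.

(** Both cardinalities are sums of exponents, so |A \ {H}| - |A^H| is [b], as the addition theorem
    requires. *)
Lemma inductive_exponents_add V (A : set {vspace V}) (H : {vspace V}) b e e' :
  A H -> (\dim H).+1 = \dim {:V} ->
  inductive_exponents (A `\ H) e' -> perm_eq (b :: e) e' ->
  inductive_exponents (restriction A H) e ->
  inductive_exponents A (b.+1 :: e).
Proof.
move=> AH dH + ee' => /inductive_exponents_perm/(_ ee') {ee'}.
move=> [[finA' codA'] indA' freeA' [sA [usA sAP ssA]]].
move=> [arrR indR freeR [sR [usR sRP ssR]]].
have AE : A = [set` H :: sA].
  apply/seteqP; split=> K /=; rewrite inE.
    have [->//|KH AK] := eqVneq K H.
    by apply/sAP; split=> //; apply/eqP.
  by case/orP => [/eqP ->//|/sAP[]].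
have codA K : A K -> (\dim K).+1 = \dim {:V}.
  have [->//|/eqP KH AK] := eqVneq K H.
  by apply: codA'; split.
have arrA : arrangement A by split=> //; apply/finite_seqP; exists (H :: sA).
split=> //.
- apply: (@inductively_free_add _ _ A H (b :: e) e) => //.
  by move=> k; rewrite /= leq_addl.
- apply: (free_addition codA AH usA sAP usR sRP) => //.
  by rewrite ssA ssR /= addnC.
exists (H :: sA); split=> [|K|].
- rewrite /= usA andbT; apply/negP => /sAP[_]; exact.
- by rewrite {1}AE.
- by rewrite /= ssA.
Qed.

End InductiveExponents.

(** * Deformations and their restrictions *)

Section DeformationRestriction.
Variable R : realType.
Implicit Types V : vectType R.

Lemma restr_eqP V (X K K' : {vspace V}) :
  restr X K = restr X K' <-> forall v, v \in X -> (v \in K) = (v \in K').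
Proof.
split=> [KK v vX|KK].
  by have /vspaceP/(_ (retr X v)) := KK; rewrite -!memv_preim incl_retr.
by apply/vspaceP => w; rewrite -!memv_preim KK // inclE subvsP.
Qed.

Lemma restriction_sub V (A B : set {vspace V}) (X : {vspace V}) :
  (forall K, A K -> ~~ (X <= K)%VS ->
     exists2 K', B K' & forall v, v \in X -> (v \in K) = (v \in K')) ->
  restriction A X `<=` restriction B X.
Proof.
move=> AB Y [K [AK XK] KY]; have [K' BK' KK'] := AB K AK XK.
exists K'; last by rewrite -KY; apply/esym/restr_eqP.
split=> //; apply: contraNN XK => /subvP XK'.
by apply/subvP => v vX; rewrite KK' // XK'.
Qed.

(** Lets the flag be computed with subspaces of the one space [V] instead of iterated
    restrictions. *)
Lemma restriction_eq_sub V (A B : set {vspace V}) (X Y : {vspace V}) :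
  (Y <= X)%VS -> restriction A X = restriction B X ->
  restriction A Y = restriction B Y.
Proof.
move=> /subvP YX.
suff E (C D : set {vspace V}) : restriction C X = restriction D X ->
    restriction C Y `<=` restriction D Y.
  by move=> AB; apply/seteqP; split; apply: E.
move=> CD; apply: restriction_sub => K CK YK.
have : restriction C X (restr X K).
  exists K => //; split=> //; apply: contraNN YK => /subvP XK.
  by apply/subvP => v /YX/XK.
rewrite CD => -[K' [DK' _] KK']; exists K' => // v /YX vX.
by apply/esym; move: v vX; apply/restr_eqP.
Qed.

(* The cone of the affine arrangement x_i - x_j = s (1-a <= s <= a), x_i = s
   (s in S i), for coordinate functions x_0, ..., x_(l-1), z on V. *)
Definition deformation V (l a : nat) (x : nat -> 'Hom(V, R^o))
    (z : 'Hom(V, R^o)) (S : nat -> int -> bool) : set {vspace V} :=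
  [set K | K = lker z
    \/ (exists i j (s : int), [/\ (i < j)%N, (j < l)%N, 1 - a%:Z <= s <= a%:Z
          & K = lker (x i - x j - s%:~R *: z)])
    \/ (exists i (s : int), [/\ (i < l)%N, S i s
          & K = lker (x i - s%:~R *: z)])].

(** Linear independence of the forms on [X], put as surjectivity of their joint evaluation, which
    supplies points with prescribed coordinates. *)
Definition independent_on V (l : nat) (x : nat -> 'Hom(V, R^o))
    (z : 'Hom(V, R^o)) (X : {vspace V}) : Prop :=
  forall (c : nat -> R) (c0 : R), exists2 v, v \in X
    & z v = c0 /\ forall i, (i < l)%N -> x i v = c i.

Lemma mem_lker_diff V (x y z : 'Hom(V, R^o)) (s : R) v :
  (v \in lker (x - y - s *: z)) = (x v - y v - s * z v == 0).
Proof. by rewrite memv_ker !(add_lfunE, opp_lfunE, scale_lfunE). Qed.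

Lemma mem_lker_coord V (x z : 'Hom(V, R^o)) (s : R) v :
  (v \in lker (x - s *: z)) = (x v - s * z v == 0).
Proof. by rewrite memv_ker !(add_lfunE, opp_lfunE, scale_lfunE). Qed.

Lemma eq_deformation V l a (x x' : nat -> 'Hom(V, R^o)) z S S' :
  (forall i, (i < l)%N -> x i = x' i) ->
  (forall i s, (i < l)%N -> S i s = S' i s) ->
  deformation l a x z S = deformation l a x' z S'.
Proof.
move=> xx SS; apply/seteqP; split=> K.
  move=> [->|[[i [j [s [ij jl sa ->]]]]|[i [s [il Ss ->]]]]]; [by left|right..].
    left; exists i, j, s; split=> //; rewrite !xx //; lia.
  by right; exists i, s; rewrite -SS // xx.
move=> [->|[[i [j [s [ij jl sa ->]]]]|[i [s [il Ss ->]]]]]; [by left|right..].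
  left; exists i, j, s; split=> //; rewrite !xx //; lia.
by right; exists i, s; rewrite SS // xx.
Qed.

(* On x_k = s0 z, the hyperplane x_i - x_k = s becomes x_i = s0 + s, and
   x_k - x_j = s becomes x_j = s0 - s. *)
Definition restr_values (a k : nat) (s0 : int) (S : nat -> int -> bool)
    (i : nat) (s : int) : bool :=
  S (bump k i) s ||
  (s0 - a%:Z + ((i < k)%N : nat)%:Z <= s < s0 + a%:Z + ((i < k)%N : nat)%:Z).

(** Any [Y] inside the hyperplane is allowed, so as to cover both the hyperplane itself and the
    members of the flag. *)
Lemma restriction_deformation V l a (x : nat -> 'Hom(V, R^o)) z S k s0
    (Y : {vspace V}) :
  (k < l.+1)%N -> (Y <= lker (x k - s0%:~R *: z))%VS ->
  restriction (deformation l.+1 a x z S) Y =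
  restriction (deformation l a (x \o bump k) z (restr_values a k s0 S)) Y.
Proof.
move=> kl /subvP Yk.
have xk v : v \in Y -> x k v = s0%:~R * z v.
  by move/Yk; rewrite mem_lker_coord subr_eq0 => /eqP.
have unbumpE i : i <> k -> bump k (unbump k i) = i.
  by move=> ik; rewrite /bump /unbump; lia.
apply/seteqP; split; apply: restriction_sub => K.
  move=> [->|[[i [j [s [ij jl sa KE]]]]|[i [s [il Ss KE]]]]] YK.
  - by exists (lker z) => //; left.
  - have [ik|/eqP ik] := eqVneq i k; last have [jk|/eqP jk] := eqVneq j k.
    + exists (lker (x j - (s0 - s)%:~R *: z)).
        right; right; exists (unbump k j), (s0 - s); split=> /=.
        * by rewrite /unbump; lia.
        * by apply/orP; right; rewrite /unbump; lia.
        * by rewrite unbumpE //; lia.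
      move=> v vY; rewrite KE mem_lker_diff mem_lker_coord ik xk //.
      by rewrite -oppr_eq0 rmorphB /=; congr (_ == _); ring.
    + exists (lker (x i - (s0 + s)%:~R *: z)).
        right; right; exists (unbump k i), (s0 + s); split=> /=.
        * by rewrite /unbump; lia.
        * by apply/orP; right; rewrite /unbump; lia.
        * by rewrite unbumpE.
      move=> v vY; rewrite KE mem_lker_diff mem_lker_coord jk xk //.
      by rewrite rmorphD /=; congr (_ == _); ring.
    + exists K => //; right; left; exists (unbump k i), (unbump k j), s.
      by rewrite KE /= !unbumpE //; split=> //; rewrite /unbump; lia.
  - have [ik|/eqP ik] := eqVneq i k; last first.
      exists K => //; right; right; exists (unbump k i), s.
      by rewrite KE /restr_values /= unbumpE // Ss; split=> //; rewrite /unbump; lia.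
    (* For [s] other than [s0], x_k = s z meets [Y] in z = 0; the case [s = s0] is excluded because
       that hyperplane contains [Y]. *)
    exists (lker z); first by left.
    move=> v vY; rewrite KE mem_lker_coord memv_ker ik xk // -mulrBl mulf_eq0.
    rewrite -rmorphB /= intr_eq0 subr_eq0; case: eqP => [ss|//].
    case/negP: YK; apply/subvP => w wY.
    by rewrite KE mem_lker_coord ik xk // ss subrr.
move=> [->|[[i [j [s [ij jl sa ->]]]]|[i [s [il Ss ->]]]]] YK.
- by exists (lker z) => //; left.
- exists (lker (x (bump k i) - x (bump k j) - s%:~R *: z)) => //.
  right; left; exists (bump k i), (bump k j), s; split=> //; rewrite /bump; lia.
- case/orP: Ss => [Ss|Ss].
    exists (lker (x (bump k i) - s%:~R *: z)) => //.
    right; right; exists (bump k i), s; split=> //; rewrite /bump; lia.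
  (* Coordinates before [k] get their window from x_i - x_k, later ones from x_k - x_i; as 1-a, ...,
     a is not symmetric, the windows differ by 1. *)
  have [ik|ki] := ltnP i k; rewrite ?ik ?(ltnNge i k) ?ki /= in Ss.
    have bi : bump k i = i by rewrite /bump; lia.
    exists (lker (x i - x k - (s - s0)%:~R *: z)).
      right; left; exists i, k, (s - s0); split=> //; lia.
    move=> v vY; rewrite [RHS]mem_lker_diff [LHS]mem_lker_coord /= bi xk //.
    by rewrite rmorphB /=; congr (_ == _); ring.
  have bi : bump k i = i.+1 by rewrite /bump; lia.
  exists (lker (x k - x i.+1 - (s0 - s)%:~R *: z)).
    right; left; exists k, i.+1, (s0 - s); split=> //; lia.
  move=> v vY; rewrite [RHS]mem_lker_diff [LHS]mem_lker_coord /= bi xk //.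
  by rewrite -oppr_eq0 rmorphB /=; congr (_ == _); ring.
Qed.

Lemma independent_on_incl V l (x : nat -> 'Hom(V, R^o)) z X :
  independent_on l x z X ->
  independent_on l (fun i => x i \o incl X)%VF (z \o incl X)%VF fullv.
Proof.
move=> xzI c c0; have [v vX [zv xv]] := xzI c c0.
exists (retr X v); first exact: memvf.
split=> [|i il]; first by rewrite comp_lfunE incl_retr.
by rewrite comp_lfunE incl_retr // xv.
Qed.

Lemma independent_on_bump V l (x : nat -> 'Hom(V, R^o)) z X k (s : R) :
  (k < l.+1)%N -> independent_on l.+1 x z X ->
  independent_on l (x \o bump k) z (X :&: lker (x k - s *: z)).
Proof.
move=> kl xzI c c0.
pose c' i := if i == k then s * c0 else c (unbump k i).
have [v vX [zv xv]] := xzI c' c0; exists v.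
  by rewrite memv_cap vX mem_lker_coord zv xv // /c' eqxx subrr eqxx.
split=> // i il; rewrite /= xv; last by rewrite /bump; lia.
by rewrite /c' (_ : (bump k i == k) = false) ?bumpK // /bump; lia.
Qed.

Lemma restriction_deformation_incl V l a (x : nat -> 'Hom(V, R^o)) z S X :
  independent_on l x z X ->
  restriction (deformation l a x z S) X =
  deformation l a (fun i => x i \o incl X)%VF (z \o incl X)%VF S.
Proof.
move=> xzI.
have coordE i (s : R) : ((x i \o incl X) - s *: (z \o incl X))%VF =
    ((x i - s *: z) \o incl X)%VF.
  by rewrite comp_lfunDl comp_lfunNl -comp_lfunZl.
have diffE i j (s : R) : ((x i \o incl X) - (x j \o incl X) - s *: (z \o incl X))%VF =
    ((x i - x j - s *: z) \o incl X)%VF.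
  by rewrite !comp_lfunDl !comp_lfunNl -comp_lfunZl.
apply/seteqP; split=> Y.
  move=> [K [+ XK] <-].
  move=> [->|[[i [j [s [ij jl sa ->]]]]|[i [s [il Ss ->]]]]];
    rewrite -[(_ @^-1: _)%VS]/(restr X _) -restr_lker; [by left|right..].
    by left; exists i, j, s; rewrite diffE.
  by right; exists i, s; rewrite coordE.
move=> [->|[[i [j [s [ij jl sa ->]]]]|[i [s [il Ss ->]]]]].
- exists (lker z); last by rewrite restr_lker.
  split; first by left.
  have [v vX [zv _]] := xzI (fun=> 0) 1; apply/negP => /subvP/(_ v vX).
  by rewrite memv_ker zv oner_eq0.
- rewrite diffE restr_lker; exists (lker (x i - x j - s%:~R *: z)) => //.
  split; first by right; left; exists i, j, s.
  have [v vX [zv xv]] := xzI (fun m => (m == i)%:R) 0.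
  apply/negP => /subvP/(_ v vX); rewrite mem_lker_diff zv !xv ?(ltn_trans ij) //.
  by rewrite eqxx (gtn_eqF ij) mulr0 !subr0 oner_eq0.
- rewrite coordE restr_lker; exists (lker (x i - s%:~R *: z)) => //.
  split; first by right; right; exists i, s.
  have [v vX [zv xv]] := xzI (fun m => (m == i)%:R) 0.
  apply/negP => /subvP/(_ v vX); rewrite mem_lker_coord zv !xv //.
  by rewrite eqxx mulr0 !subr0 oner_eq0.
Qed.

End DeformationRestriction.

Lemma perm_iota_bump (T : eqType) (f : nat -> T) k l : (k <= l)%N ->
  perm_eq (map f (iota 0 l.+1)) (f k :: map (f \o bump k) (iota 0 l)).
Proof.
move=> kl; rewrite map_comp -map_cons; apply: perm_map; apply: uniq_perm.
- exact: iota_uniq.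
- rewrite /= map_inj_uniq ?iota_uniq ?andbT; last exact: can_inj (bumpK k).
  by apply/mapP => -[i _]; rewrite /bump; lia.
move=> i; rewrite mem_iota; apply/idP/idP => [il|].
  have [->|/eqP ik] := eqVneq i k; first exact: mem_head.
  rewrite inE; apply/orP; right; apply/mapP; exists (unbump k i).
    by rewrite mem_iota /unbump; lia.
  by rewrite /bump /unbump; lia.
rewrite inE => /orP[/eqP->|/mapP[j + ->]]; first lia.
by rewrite mem_iota /bump; lia.
Qed.

(** * Adding one coordinate hyperplane *)

Section DeformationInduction.
Variable R : realType.
Implicit Types V : vectType R.

Lemma dim_subvs V (X : {vspace V}) : \dim {:subvs_of X} = \dim X.
Proof. by rewrite dimvf. Qed.

(** The deletion gives back [S] only if the new hyperplane is distinct from all old ones; for each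
    old one, independence yields a point of [H] outside it. *)
Lemma inductive_exponents_deformation_add V l a (x : nat -> 'Hom(V, R^o)) z
    (S T : nat -> int -> bool) k s0 b e e' (H := lker (x k - s0%:~R *: z)) :
  (k < l.+1)%N -> independent_on l.+1 x z fullv ->
  ~~ S k s0 ->
  (forall i s, (i < l.+1)%N -> T i s = S i s || ((i == k) && (s == s0))) ->
  inductive_exponents (deformation l.+1 a x z S) e' ->
  perm_eq (b :: e) e' ->
  inductive_exponents (deformation l a (fun i => x (bump k i) \o incl H)%VF
    (z \o incl H)%VF (restr_values a k s0 T)) e ->
  inductive_exponents (deformation l.+1 a x z T) (b.+1 :: e).
Proof.
move=> kl xzI Sk TS defS ee' defR.
have HT : deformation l.+1 a x z T H.
  by right; right; exists k, s0; split=> //; rewrite TS // !eqxx orbT.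
have delE : deformation l.+1 a x z T `\ H = deformation l.+1 a x z S.
  apply/seteqP; split=> K.
    move=> [[->|[[i [j [s [ij jl sa ->]]]]|[i [s [il + KE]]]]] KH];
      [by left|by right; left; exists i, j, s|].
    rewrite TS // => /orP[Ss|/andP[/eqP ik /eqP ss]].
      by right; right; exists i, s.
    by case: KH; rewrite KE ik ss.
  move=> SK; split.
    case: SK => [->|[[i [j [s [ij jl sa ->]]]]|[i [s [il Ss ->]]]]];
      [by left|by right; left; exists i, j, s|].
    by right; right; exists i, s; split=> //; rewrite TS // Ss.
  move=> KH; rewrite {}KH {K} in SK.
  have nH (v : V) (K : {vspace V}) : v \in H -> v \notin K -> H <> K.
    by move=> vH /negP vK HK; rewrite HK in vH.
  case: SK => [|[[i [j [s [ij jl sa]]]]|[i [s [il Ss]]]]].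
  - have [v _ [zv xv]] := xzI (fun=> s0%:~R) 1; apply: (nH v).
      by rewrite mem_lker_coord zv xv // mulr1 subrr.
    by rewrite memv_ker zv oner_eq0.
  (* The values 0, 1, 2 make x_i and x_j differ even if one of them is x_k, while z = x_k = 0 keeps
     the point on [H]. *)
  - have [v _ [zv xv]] := xzI (fun m => if m == k then 0 else
      if m == i then 1 else 2) 0.
    apply: (nH v); first by rewrite mem_lker_coord zv xv // eqxx mulr0 subrr.
    rewrite mem_lker_diff zv !xv ?(ltn_trans ij) // mulr0 subr0 (gtn_eqF ij) eqxx.
    have [ik|ik] := eqVneq i k; have [jk|jk] := eqVneq j k.
    + by move: ij; rewrite ik jk ltnn.
    + by rewrite sub0r oppr_eq0 pnatr_eq0.
    + by rewrite subr0 oner_eq0.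
    + by rewrite (_ : 1 - 2 = -1 :> R) ?oppr_eq0 ?oner_eq0 //; ring.
  - have [ik|ik] := eqVneq i k.
      have [v _ [zv xv]] := xzI (fun=> s0%:~R) 1; apply: (nH v).
        by rewrite mem_lker_coord zv xv // mulr1 subrr.
      rewrite mem_lker_coord zv xv // mulr1 subr_eq0 eqr_int.
      by apply: contraNneq Sk => ->; rewrite -ik.
    have [v _ [zv xv]] := xzI (fun m => if m == k then 0 else 1) 0.
    apply: (nH v); first by rewrite mem_lker_coord zv xv // eqxx mulr0 subrr.
    by rewrite mem_lker_coord zv xv // (negbTE ik) mulr0 subr0 oner_eq0.
have xzH : independent_on l (x \o bump k) z H.
  by have := independent_on_bump s0%:~R kl xzI; rewrite capfv.
apply: (@inductive_exponents_add _ _ _ H b e e') => //.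
- apply: dim_lker; apply/eqP => f0.
  have [v _ [zv xv]] := xzI (fun=> 1) 0.
  have : v \in H by rewrite /H f0 memv_ker zero_lfunE.
  by rewrite mem_lker_coord zv xv // mulr0 subr0 oner_eq0.
- by rewrite delE.
- by rewrite (restriction_deformation a T kl (subvv H)) // restriction_deformation_incl.
Qed.

(** [p] records a partly completed downward extension and [q] an upward one; restrictions met while
    short intervals are filled extend earlier coordinates upwards and later ones downwards. *)
Definition interval_values (lo : int) (L p q i : nat) (s : int) : bool :=
  lo - ((p <= i)%N : nat)%:Z <= s < lo + L%:Z + ((i < q)%N : nat)%:Z.

(** The number of values of coordinate [i], plus [a] for each of the other [l - 1] coordinates. *)
Definition coordinate_exponent (l a L p q i : nat) : nat :=
  (L + (p <= i) + (i < q) + a * l.-1)%N.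

(** The [k] zeros account for the dimensions of the ambient space beyond the [l + 1] forms. *)
Definition deformation_exponents (l a L p q k : nat) : seq nat :=
  1%N :: map (coordinate_exponent l a L p q) (iota 0 l) ++ nseq k 0%N.

Lemma deformation_exponents_perm l a L p q k i L' p' q' : (i <= l)%N ->
  (forall j, (j < l)%N -> coordinate_exponent l.+1 a L p q (bump i j) =
                          coordinate_exponent l a L' p' q' j) ->
  perm_eq (coordinate_exponent l.+1 a L p q i ::
           deformation_exponents l a L' p' q' k)
          (deformation_exponents l.+1 a L p q k).
Proof.
move=> il E; rewrite perm_sym /deformation_exponents.
set f := coordinate_exponent l.+1 a L p q.
have -> : map (coordinate_exponent l a L' p' q') (iota 0 l) =
          map (f \o bump i) (iota 0 l).
  by apply/eq_in_map => j; rewrite mem_iota => jl; rewrite /= -E.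
set r := map (f \o bump i) _ ++ _.
apply: (@perm_trans _ (1%N :: f i :: r)); last first.
  by have := perm_catCA [:: 1%N] [:: f i] r => /permPl.
by rewrite perm_cons -cat_cons perm_cat2r; apply: perm_iota_bump.
Qed.

Lemma deformation_exponents_nseq l a L p q k c :
  (forall j, (j < l)%N -> coordinate_exponent l a L p q j = c) ->
  deformation_exponents l a L p q k = 1%N :: nseq l c ++ nseq k 0%N.
Proof.
move=> E; congr (_ :: _ ++ _); rewrite -[in RHS](size_iota 0 l).
have : {subset iota 0 l <= [pred j | (j < l)%N]}.
  by move=> j; rewrite mem_iota inE.
elim: (iota 0 l) => //= i r IH rl; rewrite E; last by apply: rl; apply: mem_head.
by rewrite IH // => j jr; apply: rl; rewrite inE jr orbT.
Qed.

Lemma inductive_exponents_deformation0 V a (x : nat -> 'Hom(V, R^o)) z S k :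
  independent_on 0 x z fullv -> \dim {:V} = k.+1 ->
  inductive_exponents (deformation 0 a x z S) (1%N :: nseq k 0%N).
Proof.
move=> xzI dV; have defE : deformation 0 a x z S = [set lker z].
  apply/seteqP; split=> K; last by left.
  by move=> [->//|[[i [j [s [ij]]]]|[i [s []]]]].
rewrite defE.
have dz : (\dim (lker z)).+1 = \dim {:V}.
  apply: dim_lker; apply/eqP => z0; have [v _ [zv _]] := xzI (fun=> 0) 1.
  by have /eqP := oner_neq0 R; rewrite -zv z0 zero_lfunE.
apply: (@inductive_exponents_add _ _ _ (lker z) 0 _ (nseq k.+1 0%N)) => //.
- by rewrite setDv -dV; apply: inductive_exponents0.
- have -> : restriction [set lker z] (lker z) = set0.
    by apply/seteqP; split=> // Y [K [/= -> /negP[]]]; apply: subvv.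
  have -> : k = \dim {:subvs_of (lker z)} by rewrite dim_subvs; lia.
  exact: inductive_exponents0.
Qed.

End DeformationInduction.

(** * Filling the intervals value by value *)

Section IntervalDeformations.
Variables (R : realType) (a : nat).
Hypothesis a1 : (1 <= a)%N.
Implicit Types V : vectType R.

(** Quantified over the space and [k] because the induction passes to hyperplanes and, for the
    differences x_i - x_l, to the same space with one form fewer. *)
Definition interval_statement (l : nat) : Prop :=
  forall V (x : nat -> 'Hom(V, R^o)) z k, independent_on l x z fullv ->
  \dim {:V} = (l.+1 + k)%N -> forall lo L p q,
  (a <= L)%N -> (p <= l)%N -> (q <= l)%N ->
  inductive_exponents (deformation l a x z (interval_values lo L p q))
    (deformation_exponents l a L p q k).

Section Step.
Variables (l : nat) (V : vectType R) (x : nat -> 'Hom(V, R^o))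
  (z : 'Hom(V, R^o)) (k : nat).
Hypotheses (IH : interval_statement l) (xzI : independent_on l.+1 x z fullv)
  (dV : \dim {:V} = (l.+2 + k)%N).

Lemma interval_add S T i s0 b e' lo L p q :
  (i <= l)%N -> (a <= L)%N -> (p <= l)%N -> (q <= l)%N ->
  ~~ S i s0 ->
  (forall j s, (j < l.+1)%N -> T j s = S j s || ((j == i) && (s == s0))) ->
  (forall j s, (j < l)%N -> restr_values a i s0 T j s = interval_values lo L p q j s) ->
  inductive_exponents (deformation l.+1 a x z S) e' ->
  perm_eq (b :: deformation_exponents l a L p q k) e' ->
  inductive_exponents (deformation l.+1 a x z T)
    (b.+1 :: deformation_exponents l a L p q k).
Proof.
move=> il aL pl ql Si TS TR defS ee'.
have ils : (i < l.+1)%N by [].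
apply: (inductive_exponents_deformation_add ils xzI Si TS defS ee').
set H := lker _.
have xzH : independent_on l (x \o bump i) z H.
  by have := independent_on_bump s0%:~R ils xzI; rewrite capfv.
rewrite (@eq_deformation _ _ _ _ _ (fun j => x (bump i j) \o incl H)%VF _ _
  (interval_values lo L p q)) //.
apply: IH => //; first exact: (independent_on_incl xzH).
rewrite dim_subvs; apply: succn_inj; rewrite dim_lker ?dV //.
apply/eqP => f0; have [v _ [zv xv]] := xzI (fun=> 1) 0.
have : v \in H by rewrite /H f0 memv_ker zero_lfunE.
by rewrite mem_lker_coord zv xv // mulr0 subr0 oner_eq0.
Qed.

(* Without coordinate hyperplanes, x_0, ..., x_l only enter through
   x_i - x_l (i < l). *)
Lemma inductive_exponents_shi :
  inductive_exponents (deformation l.+1 a x z (fun _ _ => false))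
    (1%N :: 0%N :: nseq l (a * l.+1)%N ++ nseq k 0%N).
Proof.
have subE (u v w : 'Hom(V, R^o)) : (u - w) - (v - w) = u - v.
  by rewrite opprB addrA subrK.
(* The values 1-a, ..., a of x_i - x_l form an interval of [2 * a] values; [p = l] and [q = 0] leave
   it unextended. *)
have -> : deformation l.+1 a x z (fun _ _ => false) =
    deformation l a (fun i => x i - x l) z (interval_values (1 - a%:Z) (2 * a) l 0).
  apply/seteqP; split=> K.
    move=> [->|[[i [j [s [ij jl sa ->]]]]|[i [s [//]]]]]; first by left.
    right; have [jE|jE] := eqVneq j l.
      right; exists i, s; rewrite jE; split=> //; first lia.
      rewrite /interval_values; lia.
    left; exists i, j, s; split=> //; first lia.
    by rewrite subE.
  move=> [->|[[i [j [s [ij jl sa ->]]]]|[i [s [il Ss ->]]]]]; first by left.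
    right; left; exists i, j, s; split=> //; first lia.
    by rewrite subE.
  right; left; exists i, l, s; split=> //.
  by move: Ss; rewrite /interval_values; lia.
have yzI : independent_on l (fun i => x i - x l) z fullv.
  move=> c c0; have [v vV [zv xv]] := xzI (fun i => if (i < l)%N then c i else 0) c0.
  exists v => //; split=> // i il; rewrite add_lfunE opp_lfunE !xv ?il ?ltnn ?subr0 //.
  exact: ltnW.
have dV' : \dim {:V} = (l.+1 + k.+1)%N by lia.
have := IH yzI dV' (1 - a%:Z) (L := 2 * a) (p := l) (q := 0).
move=> /(_ _ _ _)/inductive_exponents_perm; apply; try lia.
rewrite (@deformation_exponents_nseq _ _ _ _ _ _ (a * l.+1)%N); last first.
  by move=> j jl; rewrite /coordinate_exponent; case: (l) jl => // l' jl; nia.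
rewrite perm_cons -cat1s.
by have := perm_catCA [:: 0%N] (nseq l (a * l.+1)%N) (nseq k 0%N) => /permPl.
Qed.

(** Intervals grow downwards from [hi], the last coordinate first. With at most [a] values they are
    swallowed by the windows of the restriction, which thus always has [2 * a] values per
    coordinate; only the exponent counting the coordinate hyperplanes changes. *)
Lemma inductive_exponents_short_interval hi t : (t <= a)%N ->
  inductive_exponents
    (deformation l.+1 a x z (interval_values (hi - t%:Z) t l.+1 0))
    (1%N :: (t * l.+1)%N :: nseq l (a * l.+1)%N ++ nseq k 0%N).
Proof.
elim: t => [_|t IHt ta].
  rewrite mul0n (@eq_deformation _ _ _ _ _ x _ _ (fun _ _ => false)) //.
    exact: inductive_exponents_shi.
  by move=> i s il; rewrite /interval_values; lia.
have main r : (r <= l.+1)%N -> inductive_exponents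
    (deformation l.+1 a x z (interval_values (hi - t%:Z) t (l.+1 - r) 0))
    (1%N :: (t * l.+1 + r)%N :: nseq l (a * l.+1)%N ++ nseq k 0%N).
  elim: r => [_|r IHr rl].
    by rewrite subn0 addn0; apply: IHt; lia.
  have E : deformation_exponents l a (2 * a).-1 (l - r) (l - r) k =
      1%N :: nseq l (a * l.+1)%N ++ nseq k 0%N.
    apply: deformation_exponents_nseq => j jl.
    by rewrite /coordinate_exponent; case: (l) jl => // l' jl; nia.
  have := @interval_add (interval_values (hi - t%:Z) t (l.+1 - r) 0)
    (interval_values (hi - t%:Z) t (l.+1 - r.+1) 0) (l - r) (hi - t%:Z - 1)
    (t * l.+1 + r) _ (hi - t%:Z - a%:Z) (2 * a).-1 (l - r) (l - r).
  move=> /(_ _ _ _ _ _ _ _ _ (IHr (ltnW rl))); rewrite E.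
  have P (b : nat) (s : seq nat) : perm_eq (b :: 1%N :: s) (1%N :: b :: s).
    by have := perm_catCA [:: b] [:: 1%N] s => /permPl.
  move=> add; apply: inductive_exponents_perm (add _ _ _ _ _ _ _ _) _; try lia.
  - by rewrite /interval_values; lia.
  - by move=> j s jl; rewrite /interval_values; lia.
  - by move=> j s jl; rewrite /restr_values /interval_values /bump; lia.
  - exact: P.
  - by rewrite -addnS perm_sym; apply: P.
have := main l.+1 (leqnn _); rewrite subnn.
rewrite (@eq_deformation _ _ _ _ _ x _ _
  (interval_values (hi - t.+1%:Z) t.+1 l.+1 0)) //.
  by rewrite mulSn addnC.
by move=> i s il; rewrite /interval_values; lia.
Qed.

(** Once the intervals have at least [a] values, the windows of the restriction reach below them but
    not above [hi], so every remaining interval gains [a] values. A full round of downward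
    extensions turns length [L] into [L + 1]; the rounds start at length [a], where all coordinates
    have the exponent [a * l.+1]. *)
Lemma inductive_exponents_lower_interval hi L p : (a <= L)%N -> (p <= l.+1)%N ->
  inductive_exponents
    (deformation l.+1 a x z (interval_values (hi - L%:Z) L p 0))
    (deformation_exponents l.+1 a L p 0 k).
Proof.
move=> aL; pose stage L p := inductive_exponents
  (deformation l.+1 a x z (interval_values (hi - L%:Z) L p 0))
  (deformation_exponents l.+1 a L p 0 k).
rewrite -/(stage L p).
have down M : (a <= M)%N -> stage M l.+1 -> forall r, (r <= l.+1)%N ->
    stage M (l.+1 - r)%N.
  move=> aM M0; elim=> [|r IHr] rl; first by rewrite subn0.
  have coordE q j : q = (l - r)%N \/ q = (l - r).+1 -> (j < l)%N ->
      coordinate_exponent l.+1 a M q 0 (bump (l - r) j) =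
      coordinate_exponent l a (M + a) (l - r) 0 j.
    move=> qE jl; rewrite /coordinate_exponent /bump.
    have -> : (a * l.+1.-1 = a + a * l.-1)%N by case: (l) jl => // l' _; rewrite -mulnS.
    by case: qE => ->; lia.
  have P1 : perm_eq ((M + a * l)%N :: deformation_exponents l a (M + a) (l - r) 0 k)
      (deformation_exponents l.+1 a M (l.+1 - r) 0 k).
    have -> : (M + a * l = coordinate_exponent l.+1 a M (l.+1 - r) 0 (l - r))%N.
      by rewrite /coordinate_exponent /=; lia.
    apply: deformation_exponents_perm; first lia.
    by move=> j; apply: coordE; right; lia.
  have P2 : perm_eq ((M + a * l).+1 :: deformation_exponents l a (M + a) (l - r) 0 k)
      (deformation_exponents l.+1 a M (l.+1 - r.+1) 0 k).
    have -> : ((M + a * l).+1 = coordinate_exponent l.+1 a M (l.+1 - r.+1) 0 (l - r))%N.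
      by rewrite /coordinate_exponent /=; lia.
    apply: deformation_exponents_perm; first lia.
    by move=> j; apply: coordE; left; lia.
  rewrite perm_sym in P2.
  apply: inductive_exponents_perm _ P2.
  apply: (@interval_add (interval_values (hi - M%:Z) M (l.+1 - r) 0)
    _ (l - r) (hi - M%:Z - 1) _ _ (hi - M%:Z - a%:Z) _ _ _
    _ _ _ _ _ _ _ (IHr (ltnW rl)) P1); try lia.
  - by rewrite /interval_values; lia.
  - by move=> j s jl; rewrite /interval_values; lia.
  - by move=> j s jl; rewrite /restr_values /interval_values /bump; lia.
(* [p = l.+1] is the start of a round; the other values of [p] are reached by [down]. *)
suff top : stage L l.+1 by move=> pl; rewrite -(subKn pl); apply: down => //; lia.
rewrite -(subnKC aL); elim: (L - a)%N => [|t IHt].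
  rewrite addn0 /stage (@deformation_exponents_nseq _ _ _ _ _ _ (a * l.+1)%N).
    exact: inductive_exponents_short_interval.
  by move=> j jl; rewrite /coordinate_exponent /= mulnS; lia.
have := down _ (leq_addr _ _) IHt l.+1 (leqnn _); rewrite subnn /stage.
rewrite (@eq_deformation _ _ _ _ _ x _ _
  (interval_values (hi - (a + t.+1)%N%:Z) (a + t.+1) l.+1 0)) //; last first.
  by move=> i s il; rewrite /interval_values; lia.
move/inductive_exponents_perm; apply.
rewrite !(@deformation_exponents_nseq _ _ _ _ _ _ (a + t + 1 + a * l)%N) //.
  by move=> j jl; rewrite /coordinate_exponent /=; lia.
by move=> j jl; rewrite /coordinate_exponent /=; lia.
Qed.

(** The value [lo + L] is added to the coordinates 0, ..., q - 1 in turn; on the new hyperplane the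
    other intervals grow upwards by [a]. *)
Lemma inductive_exponents_upper_interval lo L p q :
  (a <= L)%N -> (p <= l.+1)%N -> (q <= l.+1)%N ->
  inductive_exponents
    (deformation l.+1 a x z (interval_values lo L p q))
    (deformation_exponents l.+1 a L p q k).
Proof.
move=> aL pl; elim: q => [_|q IHq ql].
  by rewrite -{1}(addrK L%:Z lo); apply: inductive_exponents_lower_interval.
pose p' := if (p <= q)%N then p else p.-1.
have p'E j : ((p' <= j) = (p <= bump q j))%N.
  by rewrite /p' /bump; case: (leqP p q) => pq; lia.
have p'l : (p' <= l)%N by rewrite /p'; case: (leqP p q) => pq; lia.
have coordE r j : r = q \/ r = q.+1 -> (j < l)%N ->
    coordinate_exponent l.+1 a L p r (bump q j) =
    coordinate_exponent l a (L + a) p' q j.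
  move=> rE jl; rewrite /coordinate_exponent -p'E.
  have -> : (a * l.+1.-1 = a + a * l.-1)%N by case: (l) jl => // l' _; rewrite -mulnS.
  by rewrite /bump; case: rE => ->; lia.
set b := (L + (p <= q) + a * l)%N.
have P1 : perm_eq (b :: deformation_exponents l a (L + a) p' q k)
    (deformation_exponents l.+1 a L p q k).
  have -> : b = coordinate_exponent l.+1 a L p q q.
    by rewrite /coordinate_exponent /b /=; lia.
  by apply: deformation_exponents_perm => // j; apply: coordE; left.
have P2 : perm_eq (b.+1 :: deformation_exponents l a (L + a) p' q k)
    (deformation_exponents l.+1 a L p q.+1 k).
  have -> : b.+1 = coordinate_exponent l.+1 a L p q.+1 q.
    by rewrite /coordinate_exponent /b /=; lia.
  by apply: deformation_exponents_perm => // j; apply: coordE; right.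
rewrite perm_sym in P2.
apply: inductive_exponents_perm _ P2.
apply: (@interval_add (interval_values lo L p q)
  _ q (lo + L%:Z) _ _ lo _ _ _
  _ _ _ _ _ _ _ (IHq (ltnW ql)) P1) => //; try lia.
- by rewrite /interval_values; lia.
- by move=> j s jl; rewrite /interval_values; lia.
- move=> j s jl; rewrite /restr_values /interval_values p'E /bump; lia.
Qed.

End Step.

Theorem inductive_exponents_interval l : interval_statement l.
Proof.
elim: l => [|l IH] V x z k xzI dV lo L p q aL pl ql.
  by rewrite /deformation_exponents; apply: inductive_exponents_deformation0.
exact: inductive_exponents_upper_interval.
Qed.

End IntervalDeformations.

(** * The flag *)

Section IntervalFlag.
Variables (R : realType) (a : nat).
Hypothesis a1 : (1 <= a)%N.

Definition sorted_exponents (l L p : nat) : seq nat :=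
  1%N :: nseq p (L + a * l.-1)%N ++ nseq (l - p) (L + a * l.-1).+1.

Lemma sorted_exponentsE l L p : (p <= l)%N ->
  deformation_exponents l a L p 0 0 = sorted_exponents l L p.
Proof.
move=> pl; rewrite /deformation_exponents /sorted_exponents cats0; congr (_ :: _).
apply: (@eq_from_nth _ 0%N); rewrite size_map size_iota.
  by rewrite size_cat !size_nseq subnKC.
move=> i il; rewrite (nth_map 0%N) ?size_iota // nth_iota // add0n.
rewrite nth_cat size_nseq !nth_nseq /coordinate_exponent.
by case: (ltnP i p) => ip; case: (ltnP (i - p) (l - p)) => ip'; lia.
Qed.

Lemma size_sorted_exponents l L p : (p <= l)%N -> size (sorted_exponents l L p) = l.+1.
Proof. by move=> pl; rewrite /= size_cat !size_nseq subnKC. Qed.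

(** [A] enters only through its restriction to [X], whose shape is kept along the flag: each step
    has one coordinate less and [L + a] for [L], so the remaining exponents do not change. *)
Lemma interval_flag (V : vectType R) (A : set {vspace V}) l :
  forall (X : {vspace V}) x z lo L p,
  independent_on l x z X -> \dim X = l.+1 -> (a <= L)%N -> (p <= l)%N ->
  in_lattice A X ->
  restriction A X = restriction (deformation l a x z (interval_values lo L p 0)) X ->
  exists F : nat -> {vspace V},
    [/\ F l.+1 = X, forall d, (0 < d < l.+1)%N -> (F d <= F d.+1)%VS
      & forall d, (0 < d <= l.+1)%N ->
          [/\ in_lattice A (F d), \dim (F d) = d
            & inductive_exponents (restriction A (F d))
                (take d (sorted_exponents l L p))]].
Proof.
elim: l => [|l IH] X x z lo L p xzI dX aL pl latX AX.
  exists (fun=> X); split=> // d.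
  move=> d1; have -> : d = 1%N by lia.
  split=> //; rewrite take_oversize // -?sorted_exponentsE //.
  rewrite AX restriction_deformation_incl //.
  apply: inductive_exponents_interval => //; first exact: independent_on_incl.
  by rewrite dim_subvs dX.
(* If [p <= l], coordinate [p] has a longest interval, with lowest value [lo - 1]. Otherwise all
   intervals are equal, coordinate 0 with lowest value [lo] is taken, and [p' = l] says that no
   restricted interval is extended. *)
pose k := if (p < l.+1)%N then p else 0%N.
pose s0 := if (p < l.+1)%N then lo - 1 else lo.
pose p' := if (p < l.+1)%N then p else l.
have kl : (k < l.+1)%N by rewrite /k; case: (ltnP p l.+1).
have p'l : (p' <= l)%N by rewrite /p'; case: (ltnP p l.+1); lia.
set H := lker (x k - s0%:~R *: z); set Y := (X :&: H)%VS.
have [v vX [zv xv]] := xzI (fun=> 1) 0.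
have fv : (x k - s0%:~R *: z) v != 0.
  by rewrite -memv_ker mem_lker_coord zv xv // mulr0 subr0 oner_eq0.
(* [H] itself may lie outside [A]; some member with the same trace on [X] exists, which puts [Y]
   into the lattice. *)
have [K AK KH] : exists2 K, A K & restr X K = restr X H.
  have : restriction A X (restr X H).
    rewrite AX; exists H => //; split.
      right; right; exists k, s0; split=> //.
      by rewrite /interval_values /s0 /k; case: (ltnP p l.+1); lia.
    by apply: contraNN fv => /subvP/(_ v vX); rewrite memv_ker.
  by move=> [K [AK _] KH]; exists K.
have YE : Y = (K :&: X)%VS.
  apply/vspaceP => w; rewrite !memv_cap andbC; case: (boolP (w \in X)) => wX.
    by rewrite !andbT; move: w wX; apply/restr_eqP.
  by rewrite !andbF.
have latY : in_lattice A Y.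
  have [B [BA XB]] := latX; exists (K :: B); rewrite big_cons -XB YE; split=> //.
  by move=> K'; rewrite inE => /orP[/eqP ->//|/BA].
have dY : \dim Y = l.+1 by apply: succn_inj; rewrite (dim_cap_lker vX fv).
have AY : restriction A Y = restriction
    (deformation l a (x \o bump k) z (interval_values (lo - a%:Z) (L + a) p' 0)) Y.
  rewrite (restriction_eq_sub (capvSl X H) AX).
  rewrite (restriction_deformation _ _ kl (capvSr X H)).
  rewrite (@eq_deformation _ _ l a _ (x \o bump k) z _
    (interval_values (lo - a%:Z) (L + a) p' 0)) // => i s il.
  rewrite /restr_values /interval_values /k /s0 /p' /bump.
  by case: (ltnP p l.+1) => pl'; lia.
have [F [FY Fle FP]] := IH Y _ z _ _ p' (independent_on_bump _ kl xzI) dY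
  (leq_trans aL (leq_addr a L)) p'l latY AY.
exists (fun d => if d == l.+2 then X else F d); split=> [|d dl|d dl].
- by rewrite eqxx.
- rewrite (_ : (d == l.+2) = false); last by lia.
  have [->|dl'] := eqVneq d l.+1; first by rewrite eqxx FY capvSl.
  by rewrite (_ : (d.+1 == l.+2) = false); [apply: Fle|]; lia.
case: eqP => dE.
  split=> //; rewrite dE // take_oversize ?size_sorted_exponents //.
  rewrite -sorted_exponentsE // AX restriction_deformation_incl //.
  apply: inductive_exponents_interval => //; first exact: independent_on_incl.
  by rewrite dim_subvs dX; lia.
have [|latF dF IF] := FP d; first by lia.
split=> //.
suff -> : take d (sorted_exponents l.+1 L p) = take d (sorted_exponents l (L + a) p').
  by [].
(* The shorter list lacks only the last, largest entry, so prefixes of length at most [l.+1]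
   agree. *)
have -> : sorted_exponents l.+1 L p = sorted_exponents l (L + a) p' ++
    [:: nth 0%N (sorted_exponents l.+1 L p) l.+1].
  have E (s s' : seq nat) : size s = (size s').+1 ->
      (forall i, (i < size s')%N -> nth 0%N s i = nth 0%N s' i) ->
      s = s' ++ [:: nth 0%N s (size s')].
    move=> sz ss; apply: (@eq_from_nth _ 0%N); first by rewrite size_cat addn1.
    move=> i; rewrite sz ltnS leq_eqVlt => /orP[/eqP ->|is'].
      by rewrite nth_cat ltnn subnn.
    by rewrite nth_cat is' ss.
  rewrite -[X in nth _ _ X](@size_sorted_exponents l (L + a) p') //.
  apply: E; rewrite !size_sorted_exponents // => i il.
  case: i il => [//|i] il /=.
  rewrite !nth_cat !size_nseq !nth_nseq /p'.
  have -> : (L + a * l = L + a + a * l.-1)%N.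
    by case: (l) il => [|l'] // _; rewrite /= mulnS addnA.
  by case: (ltnP p l.+1) => pl'; do ![case: ltnP => ?]; lia.
by rewrite takel_cat // size_sorted_exponents //; lia.
Qed.

End IntervalFlag.

(** * The cone *)

Section ConeOfIntervals.
Variable R : realType.

Definition row_entry n (j : 'I_n) (v : 'rV[R]_n) : R^o := v 0 j.

Lemma row_entry_linear n (j : 'I_n) : linear (row_entry j).
Proof. by move=> k u v; rewrite /row_entry !mxE. Qed.

HB.instance Definition _ n (j : 'I_n) := GRing.isLinear.Build R 'rV[R]_n R^o _
  (row_entry j) (row_entry_linear j).

Definition cone_coord l (i : nat) : 'Hom('rV[R]_(l + 1), R^o) :=
  if insub i is Some i' then linfun (row_entry (lshift 1 (i' : 'I_l))) else 0.

Definition cone_height l : 'Hom('rV[R]_(l + 1), R^o) :=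
  linfun (row_entry (rshift l ord0)).

Lemma cone_coordE l (i : 'I_l) v : cone_coord l i v = v 0 (lshift 1 i).
Proof. by rewrite /cone_coord valK lfunE. Qed.

Lemma cone_heightE l v : cone_height l v = v 0 (rshift l ord0).
Proof. by rewrite lfunE. Qed.

Lemma cone_independent l :
  independent_on l (cone_coord l) (cone_height l) fullv.
Proof.
move=> c c0; exists (row_mx (\row_(i < l) c i) c0%:M); first exact: memvf.
split=> [|i il]; first by rewrite cone_heightE row_mxEr mxE eqxx mulr1n.
by rewrite (cone_coordE (Ordinal il)) row_mxEl mxE.
Qed.

Lemma mem_linear_hyperplane l (b : 'cV[R]_l) (d : R) (v : 'rV[R]_(l + 1)) :
  (v \in linear_hyperplane (col_mx b (- d)%:M)) =
  ((lsubmx v *m b) 0 0 - d * v 0 (rshift l ord0) == 0).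
Proof.
rewrite memv_ker lfunE /= -[X in X *m _](hsubmxK v) mul_row_col mul_mx_scalar.
move: (lsubmx v *m b) => w.
apply/eqP/eqP => [/matrixP/(_ 0 0)|E]; first by rewrite !mxE mulNr.
by apply/matrixP => i j; rewrite !ord1 !mxE mulNr.
Qed.

Lemma affine_hyperplane_point l (b : 'cV[R]_l) (d : R) :
  b != 0 -> exists x, affine_hyperplane b d x.
Proof.
move=> b0; have /existsP[k bk] : [exists k, b k 0 != 0].
  apply: contraNT b0; rewrite negb_exists => /forallP b0.
  by apply/eqP/matrixP => i j; rewrite ord1 mxE; apply/eqP; move: (b0 i); rewrite negbK.
exists ((d / b k 0) *: delta_mx 0 k).
by rewrite /affine_hyperplane /= -scalemxAl -rowE !mxE divfK.
Qed.

(** Makes the cone of an affine hyperplane independent of its equation: points with [t != 0] scale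
    into the affine hyperplane, and those with [t = 0] are its directions, differences of two of its
    points. *)
Lemma cone_hyperplane_sub l (b c : 'cV[R]_l) (d e : R) : b != 0 ->
  affine_hyperplane b d `<=` affine_hyperplane c e ->
  (linear_hyperplane (col_mx b (- d)%:M) <=
   linear_hyperplane (col_mx c (- e)%:M))%VS.
Proof.
move=> b0 bc; apply/subvP => v; rewrite !mem_linear_hyperplane !subr_eq0.
set t := v 0 _ => /eqP vb; have [t0|t0] := eqVneq t 0.
  have [x0 xb] := affine_hyperplane_point d b0.
  have xc : (x0 *m c) 0 0 = e by apply: bc.
  have : affine_hyperplane c e (x0 + lsubmx v).
    apply: bc; rewrite /affine_hyperplane /= mulmxDl mxE vb t0 mulr0 addr0.
    exact: xb.
  rewrite /affine_hyperplane /= mulmxDl mxE xc t0 mulr0 => E.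
  by apply/eqP/(addrI e); rewrite E addr0.
have : affine_hyperplane c e (t^-1 *: lsubmx v).
  by apply: bc; rewrite /affine_hyperplane /= -scalemxAl mxE vb mulrCA mulVf // mulr1.
by rewrite /affine_hyperplane /= -scalemxAl mxE => <-; rewrite mulrAC mulVf // mul1r.
Qed.

Lemma cone_hyperplane_eq l (b c : 'cV[R]_l) (d e : R) : b != 0 -> c != 0 ->
  affine_hyperplane b d = affine_hyperplane c e ->
  linear_hyperplane (col_mx b (- d)%:M) = linear_hyperplane (col_mx c (- e)%:M).
Proof.
move=> b0 c0 bc; apply/eqP; rewrite eqEsubv.
by apply/andP; split; apply: cone_hyperplane_sub => //; rewrite bc.
Qed.

Lemma mulmx_delta l (x : 'rV[R]_l) (i : 'I_l) :
  (x *m delta_mx i 0 : 'M_1) 0 0 = x 0 i.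
Proof. by rewrite -colE mxE. Qed.

Lemma affine_diff l (i j : 'I_l) (s : R) :
  [set x : 'rV[R]_l | x 0 i - x 0 j = s] =
  affine_hyperplane (delta_mx i 0 - delta_mx j 0) s.
Proof.
apply/funext => x; rewrite /affine_hyperplane /= mulmxBr.
by rewrite [in RHS]mxE [(- _ : 'M_1) 0 0]mxE !mulmx_delta.
Qed.

Lemma affine_coord l (i : 'I_l) (s : R) :
  [set x : 'rV[R]_l | x 0 i = s] = affine_hyperplane (delta_mx i 0) s.
Proof. by apply/funext => x; rewrite /affine_hyperplane /= mulmx_delta. Qed.

Lemma linear_diff l (i j : 'I_l) (s : R) :
  linear_hyperplane (col_mx (delta_mx i 0 - delta_mx j 0) (- s)%:M) =
  lker (cone_coord l i - cone_coord l j - s *: cone_height l).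
Proof.
apply/vspaceP => v; rewrite mem_linear_hyperplane mem_lker_diff.
rewrite !cone_coordE cone_heightE mulmxBr [in LHS]mxE [(- _ : 'M_1) 0 0]mxE.
by rewrite !mulmx_delta !mxE.
Qed.

Lemma linear_coord l (i : 'I_l) (s : R) :
  linear_hyperplane (col_mx (delta_mx i 0) (- s)%:M) =
  lker (cone_coord l i - s *: cone_height l).
Proof.
apply/vspaceP => v; rewrite mem_linear_hyperplane mem_lker_coord.
by rewrite cone_coordE cone_heightE mulmx_delta mxE.
Qed.

Lemma linear_infinity l :
  linear_hyperplane (col_mx 0 1%:M) = lker (cone_height l).
Proof.
apply/vspaceP => v; rewrite -[1]opprK mem_linear_hyperplane memv_ker.
by rewrite cone_heightE mulmx0 mxE sub0r mulN1r opprK.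
Qed.

Lemma delta_neq0 l (i : 'I_l) : (delta_mx i 0 : 'cV[R]_l) != 0.
Proof.
apply/eqP => /matrixP/(_ i 0)/eqP; rewrite !mxE !eqxx; exact/negP/oner_neq0.
Qed.

Lemma delta_diff_neq0 l (i j : 'I_l) : (i < j)%N ->
  (delta_mx i 0 - delta_mx j 0 : 'cV[R]_l) != 0.
Proof.
move=> ij; apply/eqP => /matrixP/(_ i 0)/eqP; rewrite !mxE !eqxx /=.
rewrite (_ : (i == j) = false) ?subr0; first exact/negP/oner_neq0.
by apply/negbTE; apply: contraTneq ij => ->; rewrite ltnn.
Qed.

(** The values from -m to na - 1 form an interval of m + na values, and the coordinates from [p] on
    have the extra lowest value -m - 1. *)
Lemma cone_arrH l p m a n : (p <= l)%N ->
  cone (arrH R l p m a n) =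
  deformation l a (cone_coord l) (cone_height l)
    (interval_values (- m%:Z) (m + n * a) p 0).
Proof.
move=> pl; apply/seteqP; split=> K.
  move=> [[b [d [b0 + ->]]]|->]; last by left; apply: linear_infinity.
  move=> [[i [j [s [ij sa E]]]]|bE]; right.
    left; exists i, j, s; split=> //.
    rewrite -linear_diff; apply: cone_hyperplane_eq => //.
      exact: delta_diff_neq0.
    by rewrite E affine_diff.
  have {bE}[i [s [iS E]]] : exists (i : 'I_l) (s : int),
      interval_values (- m%:Z) (m + n * a) p 0 i s /\
      affine_hyperplane b d = [set x : 'rV[R]_l | x 0 i = s%:~R].
    by case: bE => -[i [s [ip si E]]]; exists i, s; split=> //;
      rewrite /interval_values; lia.
  right; exists i, s; split=> //.
  rewrite -linear_coord; apply: cone_hyperplane_eq => //.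
    exact: delta_neq0.
  by rewrite E affine_coord.
move=> [->|[[i [j [s [ij jl sa ->]]]]|[i [s [il iS ->]]]]].
- by right; apply/esym/linear_infinity.
- left; pose i' := Ordinal (ltn_trans ij jl); pose j' := Ordinal jl.
  exists (delta_mx i' 0 - delta_mx j' 0), s%:~R; split.
  + exact: delta_diff_neq0.
  + by left; exists i', j', s; rewrite affine_diff.
  + by rewrite (linear_diff i' j').
- left; pose i' := Ordinal il; exists (delta_mx i' 0), s%:~R; split.
  + exact: delta_neq0.
  + right; have [pi|ip] := leqP p i; [right|left]; exists i', s;
      rewrite affine_coord; split=> //; move: iS; rewrite /interval_values; lia.
  + by rewrite (linear_coord i').
Qed.

Lemma arrK_arrH l p m d : arrK R l p m d = arrH R l p m 1 (d + 1).
Proof.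
have dE : ((d + 1) * 1)%N%:Z - 1 = d%:Z by lia.
rewrite /arrK /arrH dE.
apply/seteqP; split=> K [KE|KE]; [left| |left|]; try by right.
  case: KE => i [j [ij [->|->]]].
    by exists i, j, 0; split.
  by exists i, j, 1; split.
case: KE => i [j [s [ij s01 ->]]]; exists i, j; split=> //.
have [->|->] : s = 0 \/ s = 1 by lia.
- by left.
- by right.
Qed.

Lemma sorted_two_values p q c c' : (0 < c)%N -> (c <= c')%N ->
  sorted leq (1%N :: nseq p c ++ nseq q c').
Proof.
move=> c0 cc'; rewrite /= cat_path; apply/andP; split.
  by case: p => //= p; rewrite c0 /=; elim: p => //= p ->; rewrite leqnn.
have : (last 1%N (nseq p c) <= c')%N.
  have : last 1%N (nseq p c) \in [:: 1%N; c].
    case: p => [|p]; first by rewrite mem_head.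
    by rewrite -nth_last size_nseq nth_nseq ltnSn !inE eqxx orbT.
  by rewrite !inE => /orP[]/eqP->; lia.
by case: q => //= q ->; elim: q => //= q; rewrite leqnn.
Qed.

(** The interval length [m + n * a] is at least [a] because [n >= 1], and adding [a * (l - 1)] to it
    gives [c]. *)
Lemma cone_arrH_accurate m a n l p :
  (1 <= a)%N -> (1 <= n)%N -> (1 <= l)%N -> (p <= l)%N ->
  let c := (m + a * (l + n - 1))%N in
  ind_flag_accurate (cone (arrH R l p m a n)) /\
  free_with_exponents (cone (arrH R l p m a n))
    (1%N :: nseq p c ++ nseq (l - p) (c + 1)%N).
Proof.
move=> a1 n1 l1 pl c; rewrite cone_arrH //; set A := deformation _ _ _ _ _.
have xzI := @cone_independent l; have aL : (a <= m + n * a)%N by nia.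
have dV : \dim {:'rV[R]_(l + 1)} = l.+1 by rewrite dimvf dim_matrix; lia.
have cE : (m + n * a + a * l.-1)%N = c by rewrite /c; nia.
have eE : sorted_exponents a l (m + n * a) p =
    1%N :: nseq p c ++ nseq (l - p) (c + 1)%N.
  by rewrite /sorted_exponents cE addn1.
have [arrA indA freeA _] : inductive_exponents A (sorted_exponents a l (m + n * a) p).
  rewrite -sorted_exponentsE //; apply: inductive_exponents_interval => //.
  by rewrite dV addn0.
have latV : in_lattice A fullv by exists [::]; rewrite big_nil.
have [F [Ffull Fle FP]] := interval_flag a1 xzI dV aL pl latV erefl.
split; last by rewrite -eE.
split=> //; split=> //.
exists (sorted_exponents a l (m + n * a) p), F; rewrite dV; split=> //.
- by rewrite size_sorted_exponents.
- by apply: sorted_two_values; rewrite ?cE // /c; nia.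
- split=> // d dl; have [latF dF [_ indF freeF _]] := FP d dl.
  by split.
Qed.

End ConeOfIntervals.

Local Close Scope classical_set_scope.
Local Close Scope ring_scope.

Theorem theorem7p18 (R : realType) :
  (forall m a n l p : nat,
     (1 <= a)%N -> (1 <= n)%N -> (1 <= l)%N -> (p <= l)%N ->
     let c := (m + a * (l + n - 1))%N in
     ind_flag_accurate (cone (arrH R l p m a n)) /\
     free_with_exponents (cone (arrH R l p m a n))
       (1%N :: nseq p c ++ nseq (l - p) (c + 1)%N)) /\
  (forall m d l p : nat,
     (1 <= l)%N -> (p <= l)%N ->
     arrK R l p m d = arrH R l p m 1 (d + 1) /\
     ind_flag_accurate (cone (arrK R l p m d)) /\
     free_with_exponents (cone (arrK R l p m d))
       (1%N :: nseq p (l + m + d)%N ++ nseq (l - p) (l + m + d + 1)%N)).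
Proof.
split=> [m a n l p|m d l p l1 pl]; first exact: cone_arrH_accurate.
split; first exact: arrK_arrH.
rewrite arrK_arrH (_ : l + m + d = m + 1 * (l + (d + 1) - 1))%N; last by lia.
by apply: cone_arrH_accurate; rewrite // addn1.
Qed.
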